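(* Let $\Gamma$ be a finitely generated discrete group, let $\mathcal F\subseteq\widetilde{\mathcal F}$ be a pair of families of subgroups of $\Gamma$, and let $\{H_\alpha\}_{\alpha\in I}$ be a collection of subgroups of $\Gamma$ adapted to the pair $(\mathcal F,\widetilde{\mathcal F})$. Let $\{\Lambda_\alpha\}_{\alpha\in\tilde I}\subseteq\{H_\alpha\}_{\alpha\in I}$ be a subcollection consisting of exactly one subgroup from each $\Gamma$-conjugacy class occurring in $\{H_\alpha\}_{\alpha\in I}$. Let $X$ be a model for $E_{\mathcal F}(\Gamma)$, and let $$\widehat X = X * \coprod_{\alpha\in\tilde I} E_{\Lambda_\alpha;\Gamma}$$ be the join of $X$ with the disjoint union of the $\Gamma$-spaces $E_{\Lambda_\alpha;\Gamma}$, equipped with the induced $\Gamma$-action. Then $\widehat X$ is a model for $E_{\widetilde{\mathcal F}}(\Gamma)$.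
   Context: A family of subgroups of $\Gamma$ is a collection of subgroups closed under passing to subgroups and under conjugation in $\Gamma$. For a family $\mathcal F$ of subgroups of a group $G$, a $G$-CW-complex $E$ is a model for the classifying space $E_{\mathcal F}(G)$ if for each subgroup $H\le G$ the fixed set $E^H$ is contractible when $H\in\mathcal F$ and empty when $H\notin\mathcal F$. A collection $\{H_\alpha\}_{\alpha\in I}$ of subgroups of $\Gamma$ is adapted to the pair $(\mathcal F,\widetilde{\mathcal F})$ if: (1) for all $G,H\in\{H_\alpha\}$, either $G=H$ or $G\cap H\in\mathcal F$; (2) it is conjugacy closed: if $G\in\{H_\alpha\}$ then $gGg^{-1}\in\{H_\alpha\}$ for all $g\in\Gamma$; (3) every $G\in\{H_\alpha\}$ is self-normalizing: $N_\Gamma(G)=G$; (4) for every $G\in\widetilde{\mathcal F}\setminus\mathcal F$ there is $H\in\{H_\alpha\}$ with $G\le H$. The space $E_{H;\Gamma}$: for a subgroup $H\le\Gamma$ let $\widetilde{\mathcal F}_H=\{F\cap H : F\in\widetilde{\mathcal F}\}$, a family of subgroups of $H$, and let $E_H$ be a model for $E_{\widetilde{\mathcal F}_H}(H)$. Put $E_{H;\Gamma}=\coprod_{\Gamma/H}E_H$, one copy of $E_H$ for each left coset of $H$ in $\Gamma$; write $E_{gH}$ for the copy indexed by $gH$. Fix left coset representatives $\{g_i\}$. An element $g\in\Gamma$ acts by sending $E_{g_iH}$ to $E_{g_jH}$, where $gg_iH=g_jH$, via the map which under the identifications $E_{g_iH}\cong E_H\cong E_{g_jH}$ is the action of $g_j^{-1}gg_i\in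 H$ on $E_H$. (Different choices of representatives give $\Gamma$-equivariantly equivalent actions.) *)

(* Defs.v *)
From HB Require Import structures.
From mathcomp Require Import all_boot all_order all_algebra.
From mathcomp Require Import all_classical all_reals topology normedtype.

Set Implicit Arguments.
Unset Strict Implicit.
Unset Printing Implicit Defensive.

Import Order.TTheory GRing.Theory Num.Theory.
Import numFieldNormedType.Exports.

Local Open Scope classical_set_scope.
Local Open Scope ring_scope.

(* A subgroup of [G] is a term of MathComp's [groupClosed G].  By the
   next lemma, equality of subgroups is equality of their elements. *)
Lemma subgroup_ext (G : groupType) (H K : groupClosed G) : H =i K -> H = K.
Proof.
case: H => S [[sV] [s1] [sM]]; case: K => T [[tV] [t1] [tM]] /= eST.
have {}eST : S = T by apply: funext => x; exact: eST.
rewrite eST in sV s1 sM *.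
by rewrite (Prop_irrelevance sV tV) (Prop_irrelevance s1 t1)
  (Prop_irrelevance sM tM).
Qed.

Section SubgroupOperations.
Context (G : groupType).
Implicit Types H K : groupClosed G.

Definition capg_pred H K : {pred G} := [pred x | (x \in H) && (x \in K)].

Fact capg_invr H K : invg_closed (capg_pred H K).
Proof. by move=> x /andP[xH xK]; apply/andP; split; apply: gpredVr. Qed.

Fact capg_1 H K : 1%g \in capg_pred H K.
Proof. by apply/andP; split; apply: gpred1. Qed.

Fact capg_mul H K : mulg_closed (capg_pred H K).
Proof.
by move=> x y /andP[xH xK] /andP[yH yK]; apply/andP; split; apply: gpredM.
Qed.

Definition capg H K : groupClosed G :=
  HB.pack_for (groupClosed G) (capg_pred H K)
    (isInvClosed.Build G (capg_pred H K) (@capg_invr H K))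
    (isMul1Closed.Build G (capg_pred H K) (@capg_1 H K))
    (isMulClosed.Build G (capg_pred H K) (@capg_mul H K)).

(* [conjsg g H] is g H g^-1; recall that [x ^ g] is g^-1 x g. *)
Definition conjsg_pred (g : G) H : {pred G} := [pred x | (x ^ g)%g \in H].

Fact conjsg_invr g H : invg_closed (conjsg_pred g H).
Proof. by move=> x; rewrite !inE conjVg => /gpredVr. Qed.

Fact conjsg_1 g H : 1%g \in conjsg_pred g H.
Proof. by rewrite inE conj1g; apply: gpred1. Qed.

Fact conjsg_mul g H : mulg_closed (conjsg_pred g H).
Proof. by move=> x y; rewrite !inE conjMg; apply: gpredM. Qed.

Definition conjsg (g : G) H : groupClosed G :=
  HB.pack_for (groupClosed G) (conjsg_pred g H)
    (isInvClosed.Build G (conjsg_pred g H) (@conjsg_invr g H))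
    (isMul1Closed.Build G (conjsg_pred g H) (@conjsg_1 g H))
    (isMulClosed.Build G (conjsg_pred g H) (@conjsg_mul g H)).

Definition normalizer H : set G := [set g | conjsg g H = H].

Definition finitely_generated :=
  exists s : seq G, forall H, {subset s <= H} -> forall g, g \in H.

Definition is_family (F : set (groupClosed G)) :=
  (forall H K, F H -> {subset K <= H} -> F K) /\
  (forall g H, F H -> F (conjsg g H)).

Definition adapted (F Ft Hs : set (groupClosed G)) :=
  [/\ forall H K, Hs H -> Hs K -> H = K \/ F (capg H K),
      forall g H, Hs H -> Hs (conjsg g H),
      forall H, Hs H -> normalizer H = [set` H] &
      forall K, (Ft `\` F) K -> exists2 H, Hs H & {subset K <= H}].

End SubgroupOperations.

Definition subgroup_type (G : groupType) (H : groupClosed G) : Type :=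
  {x : G | x \in H}.

Section SubgroupType.
Context (G : groupType) (H : groupClosed G).

HB.instance Definition _ := SubType.on (subgroup_type H).
HB.instance Definition _ := Choice.on (subgroup_type H).

Fact subgroup_closed : group_closed (mem H).
Proof. by split; [apply: gpred1 | move=> x y; apply: gpredF]. Qed.

HB.instance Definition _ :=
  SubChoice_isSubGroup.Build G _ (subgroup_type H) subgroup_closed.

(* The family {L ∩ H : L ∈ F}, as a family of subgroups of the group H. *)
Definition restrict_family (F : set (groupClosed G)) :
    set (groupClosed (subgroup_type H)) :=
  [set K | exists2 L, F L &
    forall x : subgroup_type H, (x \in K) = (val x \in L)].

End SubgroupType.

Arguments restrict_family {G} H F.

Section Cosets.
Context (G : groupType) (H : groupClosed G).

(* The coset gH. *)
Definition lcoset_set (g : G) : set G := [set x | (g^-1 * x)%g \in H].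

Definition lcosets : Type := set_type (range lcoset_set).

HB.instance Definition _ := Choice.on lcosets.

Fact lcoset_act_subproof (g : G) (A : lcosets) :
  [set x | val A (g^-1 * x)%g] \in range lcoset_set.
Proof.
case: A => A /= /set_mem[g0 _ <-]; apply/mem_set; exists (g * g0)%g => //.
by apply: funext => x; rewrite /lcoset_set /= invgM mulgA.
Qed.

Definition lcoset_act (g : G) (A : lcosets) : lcosets :=
  exist _ [set x | val A (g^-1 * x)%g] (lcoset_act_subproof g A).

Record coset_repr := CosetRepr {
  coset_repr_fun :> lcosets -> G;
  coset_reprP : forall A, val A (coset_repr_fun A)
}.

Fact coset_cocycle_subproof (r : coset_repr) (g : G) (A : lcosets) :
  ((r (lcoset_act g A))^-1 * g * r A)%g \in H.
Proof.
have := coset_reprP r (lcoset_act g A); have := coset_reprP r A.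
have [g0 _ eA] := set_mem (valP A); rewrite /= -eA /lcoset_set /=.
set a := r A; set b := r _ => ga gb.
have -> : (b^-1 * g * a = (g0^-1 * (g^-1 * b))^-1 * (g0^-1 * a))%g.
  by rewrite !invgM !invgK -!mulgA mulVKg.
by apply: gpredM => //; apply: gpredVr.
Qed.

Definition coset_cocycle (r : coset_repr) (g : G) (A : lcosets) :
  subgroup_type H :=
  exist _ ((r (lcoset_act g A))^-1 * g * r A)%g
    (coset_cocycle_subproof r g A).

End Cosets.

(* E_{H;G}: one copy of [E] for each left coset of [H]. *)
Definition induced_space (G : groupType) (H : groupClosed G)
  (E : topologicalType) : Type := {_ : lcosets H & E}.

HB.instance Definition _ (G : groupType) (H : groupClosed G)
  (E : topologicalType) := Topological.on (induced_space H E).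

(* [g] maps the copy of [E] indexed by the coset g_i H, with representative
   g_i = [r (g_i H)], to the copy indexed by g g_i H = g_j H, through the action
   of g_j^-1 g g_i. *)
Definition induced_act (G : groupType) (H : groupClosed G)
    (E : topologicalType) (act : subgroup_type H -> E -> E)
    (r : coset_repr H) (g : G) (p : induced_space H E) : induced_space H E :=
  existT _ (lcoset_act g (projT1 p))
    (act (coset_cocycle r g (projT1 p)) (projT2 p)).

Definition coprod_act (G : groupType) (J : choiceType)
    (E : J -> topologicalType) (act : forall j, G -> E j -> E j)
    (g : G) (p : {j : J & E j}) : {j : J & E j} :=
  existT _ (projT1 p) (act (projT1 p) g (projT2 p)).

Section Cells.
Context (R : realType) (n : nat).

(* Euclidean discs and spheres; [disc] and [open_disc] are a point, and
   [sphere] is empty, for [n = 0]. *)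
Definition disc : set 'rV[R]_n := [set x | \sum_i x 0 i ^+ 2 <= 1].
Definition open_disc : set 'rV[R]_n := [set x | \sum_i x 0 i ^+ 2 < 1].
Definition sphere : set 'rV[R]_n := [set x | \sum_i x 0 i ^+ 2 = 1].

End Cells.

Section GSpaces.
Context (R : realType) (G : groupType).

Section OneSpace.
Context (E : topologicalType) (act : G -> E -> E).

(* [G] is discrete, so joint continuity is continuity of each translation. *)
Definition is_action :=
  [/\ forall x, act 1%g x = x,
      forall g h x, act (g * h)%g x = act g (act h x) &
      forall g, continuous (act g)].

Definition fixed_set (H : groupClosed G) : set E :=
  [set x | forall h, h \in H -> act h x = x].

(* [B] is obtained from [A] by attaching equivariant [n]-cells, i.e. there
   is a pushout square of G-spaces
        ∐_i G/H_i × S^{n-1} --> A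
               |                |
        ∐_i G/H_i ×   D^n   --> B.
   The G-map G/H_i × D^n -> B is (gH_i, x) |-> g (Q_i x), with [Q_i] continuous
   on D^n and with values fixed by [H_i].  The fields [cell_sub], [cell_cover]
   and [cell_inj] say that B is the pushout as a set, and [cell_closed] that it
   is the pushout as a space; closed subsets of D^n are closed in R^n. *)
Record pushout_cells (n : nat) (A B : set E) (I : Type)
    (H : I -> groupClosed G) (Q : I -> 'rV[R]_n -> E) : Prop := PushoutCells {
  cell_continuous : forall i, {within disc (R := R) (n := n), continuous (Q i)};
  cell_fixed : forall i x, disc x -> fixed_set (H i) (Q i x);
  cell_boundary : forall g i x, sphere x -> A (act g (Q i x));
  cell_sub : A `<=` B;
  cell_cover : forall y, (B `\` A) y <->
    exists g i x, open_disc x /\ y = act g (Q i x);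
  cell_inj : forall g g' i i' x x', open_disc x -> open_disc x' ->
    act g (Q i x) = act g' (Q i' x') ->
    [/\ i = i', (g^-1 * g')%g \in H i & x = x'];
  cell_closed : forall C : set E, C `<=` B ->
    closed (C : set (subspace B)) <->
    closed (C `&` A : set (subspace A)) /\
    forall g i, closed [set x | disc x /\ C (act g (Q i x))]
}.

Definition attach_cells (n : nat) (A B : set E) :=
  exists (I : Type) (H : I -> groupClosed G) (Q : I -> 'rV[R]_n -> E),
    pushout_cells A B H Q.

(* [skel n] is the (n-1)-skeleton.  Spaces are Hausdorff, as usual. *)
Definition is_gcw :=
  [/\ is_action, hausdorff_space E &
  exists skel : nat -> set E,
  [/\ skel 0%N = set0,
      forall n g x, skel n x -> skel n (act g x),
      \bigcup_n skel n = setT,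
      forall n, attach_cells n (skel n) (skel n.+1) &
      forall C : set E, closed C <->
        forall n, closed (C `&` skel n : set (subspace (skel n)))]].

End OneSpace.

Definition contractible (E : topologicalType) (A : set E) :=
  exists2 a, A a & exists h : E * R -> E,
  [/\ {within A `*` `[0, 1], continuous h},
      forall x (t : R), A x -> t \in `[0, 1] -> A (h (x, t)),
      forall x, A x -> h (x, 0) = x &
      forall x, A x -> h (x, 1) = a].

(* [E], with the action [act], is a model for the classifying space E_F(G). *)
Definition is_model (F : set (groupClosed G)) (E : topologicalType)
    (act : G -> E -> E) :=
  is_gcw act /\
  forall H, (F H -> contractible (fixed_set act H)) /\
            (~ F H -> fixed_set act H = set0).

End GSpaces.

(* The topology on [T] in which a set is open when its trace on every compact
   subset is relatively open.  For Hausdorff [T] this is the associated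
   compactly generated topology. *)
Definition kspace (T : Type) : Type := T.

Section KSpace.
Context (T : topologicalType).

HB.instance Definition _ := Choice.on (kspace T).

Definition kopen : set (set (kspace T)) :=
  [set U | forall K : set T, compact K -> open (U `&` K : set (subspace K))].

Fact kopenT : kopen setT.
Proof. by move=> K _; rewrite open_subspaceIT; exact: openT. Qed.

Fact kopenI : setI_closed kopen.
Proof.
move=> U V oU oV K cK; rewrite open_subspaceIT.
by apply: openI; rewrite -open_subspaceIT; [exact: oU | exact: oV].
Qed.

Fact kopen_bigU (I : Type) (f : I -> set (kspace T)) :
  (forall i, kopen (f i)) -> kopen (\bigcup_i f i).
Proof.
move=> of_ K cK; rewrite open_subspaceIT.
by apply: bigcup_open => i _; rewrite -open_subspaceIT; exact: of_.
Qed.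

HB.instance Definition _ :=
  isOpenTopological.Build (kspace T) kopenT kopenI kopen_bigU.

End KSpace.

Section Join.
Context (R : realType) (X Y : topologicalType).

(* The underlying set X ⊔ X × ]0, 1[ × Y ⊔ Y of the join X * Y, which is the
   quotient of X ⊔ X × [0, 1] × Y ⊔ Y by (x, 0, y) ~ x and (x, 1, y) ~ y.
   The summands X and Y only matter when the other space is empty: they make
   X * ∅ = X and ∅ * Y = Y. *)
Inductive join : Type :=
| join_inl of X
| join_mid of X & {t : R | 0 < t < 1} & Y
| join_inr of Y.

HB.instance Definition _ := gen_eqMixin join.
HB.instance Definition _ := gen_choiceMixin join.

(* The quotient map on X × [0, 1] × Y. *)
Definition join_pi (p : X * (`[0, 1]%classic : set R) * Y) : join :=
  let: (x, t, y) := p in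
  if insub (val t) is Some t' then join_mid x t' y
  else if val t == 0 then join_inl x else join_inr y.

(* The quotient topology, the product X × [0, 1] × Y being formed in compactly
   generated spaces, so that the join of CW-complexes is a CW-complex. *)
Definition join_open : set (set join) :=
  [set U | [/\ open (join_inl @^-1` U), open (join_inr @^-1` U) &
    open (join_pi @^-1` U : set (kspace (X * (`[0, 1]%classic : set R) * Y)))]].

Fact join_openT : join_open setT.
Proof. by split; exact: openT. Qed.

Fact join_openI : setI_closed join_open.
Proof.
by move=> U V [? ? ?] [? ? ?]; split; rewrite preimage_setI; exact: openI.
Qed.

Fact join_open_bigU (I : Type) (f : I -> set join) :
  (forall i, join_open (f i)) -> join_open (\bigcup_i f i).
Proof.
move=> of_; split; rewrite preimage_bigcup; apply: bigcup_open => i _;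
  by case: (of_ i).
Qed.

HB.instance Definition _ :=
  isOpenTopological.Build join join_openT join_openI join_open_bigU.

Definition join_act (G : Type) (actX : G -> X -> X) (actY : G -> Y -> Y)
    (g : G) (p : join) : join :=
  match p with
  | join_inl x => join_inl (actX g x)
  | join_mid x t y => join_mid (actX g x) t (actY g y)
  | join_inr y => join_inr (actY g y)
  end.

End Join.

(* Main.v *)
Require Import Defs.
From HB Require Import structures.
From mathcomp Require Import all_boot all_order all_algebra.
From mathcomp Require Import all_classical all_reals topology normedtype.
From mathcomp Require Import realfun.
From mathcomp Require Import lra.

Set Implicit Arguments.
Unset Strict Implicit.
Unset Printing Implicit Defensive.

Import Order.TTheory GRing.Theory Num.Theory.
Import numFieldNormedType.Exports.

Local Open Scope classical_set_scope.
Local Open Scope ring_scope.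

(** A subgroup [M] fixes a point of the join [X * Y] if and only if it fixes the
   coordinates of that point, so the fixed set of [M] is the join of the fixed
   sets in [X] and in [Y], where [Y] is the union of the induced spaces.  There
   are three cases.
   - If [M] belongs to [F], then [X^M] is contractible, and the join of a
     contractible space with any space is contractible ([contractible_subjoin]):
     contract [X^M] to a point, then the resulting cone to its apex.
   - If [M] belongs to [Ft] and not to [F], then [X^M] is empty, and what remains
     is [Y^M].  The copy of [E j] over a coset [a Lambda_j] is preserved by [M] if
     and only if [M] is contained in [a Lambda_j a^-1], and then the fixed set of
     [M] in it is that of [a^-1 M a] in [E j] ([fixed_set_induced]), which is
     contractible.  There is such a coset because every member of [Ft] outside [F]
     lies in some [H i], and there is only one ([unique_fixed_coset]) because
     distinct members of the collection intersect in a member of [F], each is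
     self-normalizing, and each conjugacy class is represented by one [Lambda j].
   - If [M] is not in [Ft], both fixed sets are empty: if [M] fixed a point over
     [a Lambda_j], then [a^-1 M a] would be the intersection of [Lambda_j] with a
     member of [Ft] ([restrict_familyP]).

   Most of the work is to show that the join is a G-CW-complex.  For this a
   G-CW-structure is described by the collection of all its cells ([gcells]), with
   the weak topology and a form of closure-finiteness; this is equivalent to the
   description by skeleta ([is_gcw_gcells] and [gcells_is_gcw]).  The description by
   cells passes to disjoint unions and to induced spaces cell by cell.  In the join
   of [X] and [Y] ([join_gcells]), besides the cells of [X] and of [Y], there is one
   cell of dimension [m + 1 + n] for each orbit of pairs of an [m]-cell and an
   [n]-cell, that is, for each double coset of their stabilizers; it is
   parametrized by [D^m × [0, 1] × D^n], which is a Euclidean disc by radial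
   rescaling ([disc_split]).  The join has the quotient topology of the compactly
   generated product, so its closed sets are detected on compact subsets of
   [X × [0, 1] × Y].  Such a subset meets finitely many cells of each factor
   ([compact_finite_cells]), which gives the weak topology.  The weak topology in
   turn reduces the continuity of the contraction of a join to its restriction to
   the cells, which are compact ([homotopy_continuous]). *)

Lemma existT_inj (I : Type) (P : I -> Type) i (x y : P i) :
  existT P i x = existT P i y -> x = y.
Proof.
by move=> e; have := projT2_eq e; rewrite (Prop_irrelevance (projT1_eq e) erefl).
Qed.

(** * Point-set topology *)

Section WithinContinuity.
Context {T U V : topologicalType}.

Lemma within_closed_preimage (A : set T) (f : T -> U) (C : set U) :
  closed A -> {within A, continuous f} -> closed C ->
  closed [set x | A x /\ C (f x)].
Proof.
move=> cA /continuous_closedP fA /fA /closed_subspaceP[B cB eB].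
rewrite (_ : [set x | _] = B `&` A); first exact: closedI.
by rewrite eB; apply/seteqP; split=> x [].
Qed.

Lemma closed_within_continuous (A : set T) (f : T -> U) :
  (forall C, closed C -> closed [set x | A x /\ C (f x)]) ->
  {within A, continuous f}.
Proof.
move=> fA; apply/continuous_closedP => C cC; apply/closed_subspaceP.
exists [set x | A x /\ C (f x)]; first exact: fA.
by apply/seteqP; split=> x [] => [[]|].
Qed.

Lemma within_continuous_comp (A : set T) (B : set U) (f : T -> U) (g : U -> V) :
  {within A, continuous f} -> (forall x, A x -> B (f x)) ->
  {within B, continuous g} -> {within A, continuous (g \o f)}.
Proof.
move=> /continuous_closedP fA fAB /continuous_closedP gB.
apply/continuous_closedP => C /gB /closed_subspaceP[D cD eD].
apply/closed_subspaceP; have /closed_subspaceP[D' cD' eD'] := fA _ cD.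
exists D' => //; rewrite eD'; apply/seteqP; split=> x [/= Dx Ax]; split=> //.
  by have [] : (g @^-1` C `&` B) (f x) by rewrite -eD; split=> //; exact: fAB.
by have [] : (D `&` B) (f x) by rewrite eD; split=> //; exact: fAB.
Qed.

Lemma continuous_comp_within (A : set T) (f : T -> U) (g : U -> V) :
  {within A, continuous f} -> continuous g -> {within A, continuous (g \o f)}.
Proof.
move=> fA gc; apply: (within_continuous_comp (B := setT)) => //.
exact: continuous_subspaceT.
Qed.

Lemma within_continuous_pair (A : set T) (f : T -> U) (g : T -> V) :
  {within A, continuous f} -> {within A, continuous g} ->
  {within A, continuous (fun x => (f x, g x))}.
Proof. by move=> fA gA x; apply: cvg_pair; [exact: fA | exact: gA]. Qed.

End WithinContinuity.

Section Continuity.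
Context {T U V : topologicalType}.

Lemma fst_continuous : continuous (@fst T U).
Proof. by move=> p; exact: cvg_fst. Qed.

Lemma snd_continuous : continuous (@snd T U).
Proof. by move=> p; exact: cvg_snd. Qed.

Lemma comp_continuous (f : T -> U) (g : U -> V) :
  continuous f -> continuous g -> continuous (fun x => g (f x)).
Proof. by move=> fc gc x; apply: continuous_comp; [exact: fc | exact: gc]. Qed.

Lemma pair_continuous (f : T -> U) (g : T -> V) :
  continuous f -> continuous g -> continuous (fun x => (f x, g x)).
Proof. by move=> fc gc x; apply: cvg_pair; [exact: fc | exact: gc]. Qed.

End Continuity.

Section CompactImages.
Context {T U : topologicalType}.

Lemma within_compact_image (A B : set T) (f : T -> U) :
  {within A, continuous f} -> B `<=` A -> compact B -> compact (f @` B).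
Proof.
by move=> fA BA; apply: continuous_compact; exact: continuous_subspaceW fA.
Qed.

End CompactImages.

Lemma hausdorff_prod (T U : topologicalType) :
  hausdorff_space T -> hausdorff_space U -> hausdorff_space (T * U)%type.
Proof.
move=> hT hU [x y] [x' y'] cl; congr (_, _).
  apply: hT => A B xA xB.
  have [||[z w] [/= Az Bz]] := cl (A `*` setT) (B `*` setT).
  - by exists (A, setT) => //; split=> //; exact: filterT.
  - by exists (B, setT) => //; split=> //; exact: filterT.
  by exists z; case: Az Bz => ? _ [].
apply: hU => A B xA xB.
have [||[z w] [/= Az Bz]] := cl (setT `*` A) (setT `*` B).
- by exists (setT, A) => //; split=> //; exact: filterT.
- by exists (setT, B) => //; split=> //; exact: filterT.
by exists w; case: Az Bz => _ ? [].
Qed.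

(** If [S] were infinite, the filter of the sets containing all but finitely many
   points of [S] would have a cluster point [p] in [K]; but [S `\ p] is a closed
   member of this filter. *)
Lemma compact_discrete_finite (T : topologicalType) (K S : set T) :
  compact K -> S `<=` K -> (forall S', S' `<=` S -> closed S') ->
  finite_set S.
Proof.
move=> cK SK cS; apply: contrapT => infS.
pose F : set_system T := [set A | finite_set (S `\` A)].
have FF : ProperFilter F.
  split; first by rewrite /F /= setD0.
  split.
  - by rewrite /F /= setDT.
  - move=> A B; rewrite /F /= setDIr => fA fB; by rewrite finite_setU.
  - move=> A B AB; rewrite /F /=; apply: sub_finite_set.
    exact: setDS.
have FK : F K by rewrite /F /= (_ : S `\` K = set0) // setD_eq0.
have [p [Kp]] := cK F FF FK; rewrite clusterE => /(_ (S `\ p)).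
have /closure_id <- : closed (S `\ p) by apply: cS => x [].
have FSp : F (S `\ p).
  by rewrite /F /= setDD; apply: sub_finite_set (finite_set1 p) => x [].
by move=> /(_ FSp)[_]; apply.
Qed.

(** * Euclidean discs *)

Section Discs.
Context {R : realType}.

Definition sqnorm n (x : 'rV[R]_n) : R := \sum_i x 0 i ^+ 2.

Lemma sqnorm_ge0 n (x : 'rV[R]_n) : 0 <= sqnorm x.
Proof. by apply: sumr_ge0 => i _; exact: sqr_ge0. Qed.

Lemma sqnorm_continuous n : continuous (@sqnorm n).
Proof.
move=> x; have nx := nbhs_filter x.
apply: (@cvg_big _ _ _ _ _ _ _ (nbhs x)) => [|i _].
  exact: add_continuous.
by apply: cvgM; exact: coord_continuous.
Qed.

Lemma closed_disc n : closed (@disc R n).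
Proof.
apply: (@preimage_closed _ _ (@sqnorm n) [set r | r <= 1]).
  by move=> x _; exact: sqnorm_continuous.
exact: closed_le.
Qed.

Lemma closed_sphere n : closed (@sphere R n).
Proof.
apply: (@preimage_closed _ _ (@sqnorm n) [set r | r = 1]).
  by move=> x _; exact: sqnorm_continuous.
exact: closed_eq.
Qed.

Lemma open_disc_disc n (x : 'rV[R]_n) : open_disc x -> disc x.
Proof. exact: ltW. Qed.

Lemma sphere_disc n (x : 'rV[R]_n) : sphere x -> disc x.
Proof. by rewrite /sphere /disc /= => ->. Qed.

Lemma discE n (x : 'rV[R]_n) : disc x <-> sphere x \/ open_disc x.
Proof.
rewrite /sphere /disc /open_disc /= le_eqVlt.
by split=> [/orP[/eqP|]|[/eqP|]] ->; auto; rewrite orbT.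
Qed.

Lemma sphere_open_disc n (x : 'rV[R]_n) : sphere x -> ~ open_disc x.
Proof. by rewrite /sphere /open_disc /= => ->; rewrite ltxx. Qed.

(** The sup norm of a point of the disc is at most 1. *)
Lemma compact_disc n : compact (@disc R n).
Proof.
apply: (subclosed_compact (@closed_disc n)
  (rV_compact (fun=> segment_compact (a := -1) (b := 1)))).
move=> x xD i; rewrite /= in_itv /= -ler_norml -(@expr_le1 _ 2) //.
rewrite real_normK ?num_real //; apply: le_trans xD.
by rewrite (bigD1 i) //= lerDl; apply: sumr_ge0 => j _; exact: sqr_ge0.
Qed.

Lemma compact_sphere n : compact (@sphere R n).
Proof.
apply: (subclosed_compact (@closed_sphere n) (@compact_disc n)).
exact: sphere_disc.
Qed.

Lemma hausdorff_rV n : hausdorff_space 'rV[R]_n.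
Proof. exact: norm_hausdorff. Qed.

End Discs.

(** * Equivariant cell structures *)

Section GCells.
Context {R : realType} {G : groupType}.

(** A G-CW structure described by all its cells at once, without reference to
   skeleta: [Q i] is the characteristic map of the cell [G/H i × D^(d i)], and
   its translates are the maps [act g \o Q i].  Unlike the inductive
   description, this one is visibly stable under disjoint unions, induction and
   joins.  The field [gc_bdry_weak] stands for closure-finiteness: it says that
   the closedness of the trace of [C] on the boundary of a cell can be tested on
   the cells of smaller dimension. *)
Record gcells (E : topologicalType) (act : G -> E -> E) (I : Type)
    (d : I -> nat) (H : I -> groupClosed G)
    (Q : forall i, 'rV[R]_(d i) -> E) : Prop := GCells {
  gc_action : is_action act;
  gc_hausdorff : hausdorff_space E;
  gc_continuous : forall i,
    {within @disc R (d i), continuous (Q i)};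
  gc_fixed : forall i x, disc x -> fixed_set act (H i) (Q i x);
  gc_cover : forall y, exists g i x, open_disc x /\ y = act g (Q i x);
  gc_inj : forall g g' i i' x x', open_disc x -> open_disc x' ->
    act g (Q i x) = act g' (Q i' x') ->
    existT (fun i => 'rV[R]_(d i)) i x = existT _ i' x' /\
    (g^-1 * g')%g \in H i;
  gc_bdry : forall i x, sphere x -> exists g i' x',
    [/\ (d i' < d i)%N, open_disc x' & Q i x = act g (Q i' x')];
  gc_weak : forall C : set E,
    (forall g i, closed [set x | disc x /\ C (act g (Q i x))]) -> closed C;
  gc_bdry_weak : forall (C : set E) i,
    (forall g i', (d i' < d i)%N ->
      closed [set x | disc x /\ C (act g (Q i' x))]) ->
    closed [set x | sphere x /\ C (Q i x)]
}.

Section Theory.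
Context {E : topologicalType} {act : G -> E -> E} {I : Type} {d : I -> nat}
  {H : I -> groupClosed G} {Q : forall i, 'rV[R]_(d i) -> E}.
Arguments Q : clear implicits.
Hypothesis gcE : gcells act H Q.

Definition open_cell g i : set E := (fun x => act g (Q i x)) @` @open_disc R _.
Definition closed_cell g i : set E := (fun x => act g (Q i x)) @` @disc R _.

Lemma open_cell_closed_cell g i : open_cell g i `<=` closed_cell g i.
Proof. by move=> y [x /open_disc_disc xD <-]; exists x. Qed.

Lemma act_cellM g h i x : act (g * h)%g (Q i x) = act g (act h (Q i x)).
Proof. by case: (gc_action gcE). Qed.

Lemma cell_within_continuous g i :
  {within @disc R (d i), continuous (fun x => act g (Q i x))}.
Proof.
apply: (continuous_comp_within (gc_continuous gcE (i := i))).
by case: (gc_action gcE).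
Qed.

Lemma closed_trace (C : set E) g i :
  closed C -> closed [set x | disc x /\ C (act g (Q i x))].
Proof.
move=> cC; apply: within_closed_preimage cC; first exact: closed_disc.
exact: cell_within_continuous.
Qed.

(** Two translates of a cell that meet differ by an element of its stabilizer,
   which fixes the image of the characteristic map pointwise. *)
Lemma open_cell_eq g i g' i' :
  open_cell g i `&` open_cell g' i' !=set0 -> open_cell g i = open_cell g' i'.
Proof.
move=> [y [[x xD <-] [x' x'D eq]]].
have [eqi gg'] := gc_inj gcE xD x'D (esym eq).
have ei : i' = i by case: eqi.
subst i'; have [_ aM _] := gc_action gcE.
have eQ z : open_disc z -> act g' (Q i z) = act g (Q i z).
  move=> zD; have := gc_fixed gcE (open_disc_disc zD) gg'.
  by move/(congr1 (act g)); rewrite -aM mulVKg.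
by apply/seteqP; split=> _ [z zD <-]; exists z; rewrite ?eQ.
Qed.

(** By induction on the dimension, [gc_bdry_weak] provides the closedness of the
   trace of [C] on the boundary of each cell. *)
Lemma closed_cellwise (C : set E) :
  (forall g i, closed [set x | sphere x /\ C (act g (Q i x))] ->
    closed [set x | disc x /\ C (act g (Q i x))]) -> closed C.
Proof.
move=> hC; apply: (gc_weak gcE) => g i.
have [n] := ubnP (d i); elim: n => // n IHn in g i *.
rewrite ltnS => din; apply: (hC g i).
have := @gc_bdry_weak _ _ _ _ _ _ gcE [set y | C (act g y)] i; apply.
move=> g' i' di'; under eq_set do rewrite /= -act_cellM.
by apply: IHn; exact: leq_trans di' din.
Qed.

(** The open cells meeting [K] are finitely many: one point of [K] chosen in
   each of them gives a set all of whose subsets are closed. *)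
Lemma compact_finite_cells (K : set E) : compact K ->
  exists T : set (set E), [/\ finite_set T, K `<=` \bigcup_(A in T) A &
    forall A, T A -> exists g i,
      A = closed_cell g i /\ open_cell g i `&` K !=set0].
Proof.
move=> cK.
have /choice[c cP] : forall y, exists gi : G * I, open_cell gi.1 gi.2 y.
  by move=> y; have [g [i [x [xD ->]]]] := gc_cover gcE y; exists (g, i), x.
pose cell y := open_cell (c y).1 (c y).2.
have cell_eq y g i : open_cell g i y -> cell y = open_cell g i.
  by move=> yc; apply: open_cell_eq; exists y; split=> //; exact: cP.
(* The choice made by [xget] depends only on the set [cell y `&` K], so that
   [f] has at most one value in each open cell. *)
pose f y := xget y (cell y `&` K).
have fP y : K y -> (cell y `&` K) (f y).
  by move=> Ky; apply: xgetPex; exists y; split=> //; exact: cP.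
have finS : finite_set (f @` K).
  apply: compact_discrete_finite cK _ _ => [_ [y /fP[_ ?] <-] // | S' S'f].
  apply: closed_cellwise => g i cS.
  have S'1 x x' : open_disc x -> open_disc x' ->
      S' (act g (Q i x)) -> S' (act g (Q i x')) -> x = x'.
    move=> xD x'D Sx Sx'.
    have Sf z : open_disc z -> S' (act g (Q i z)) ->
        exists y, act g (Q i z) = xget y (open_cell g i `&` K) /\
          (open_cell g i `&` K) y.
      move=> zD /S'f[y Ky fy].
      have ey : cell y = open_cell g i.
        apply: open_cell_eq; exists (f y); split; first by case: (fP y Ky).
        by rewrite fy; exists z.
      by exists y; rewrite -fy /f -ey; split=> //; split=> //; exact: cP.
    have [y [ey Ky]] := Sf _ xD Sx; have [y' [ey' _]] := Sf _ x'D Sx'.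
    have e : act g (Q i x) = act g (Q i x').
      by rewrite ey ey' /xget; case: pselect => // -[]; exists y; apply/asboolP.
    by have [+ _] := gc_inj gcE xD x'D e; exact: existT_inj.
  rewrite (_ : [set x | _] = [set x | sphere x /\ S' (act g (Q i x))] `|`
      [set x | open_disc x /\ S' (act g (Q i x))]); last first.
    apply/seteqP; split=> x /=.
      by move=> [/discE[]]; [left | right].
    by move=> [[xD ?]|[xD ?]]; split=> //; apply/discE; [left | right].
  apply: closedU => //.
  have [[x [xD Sx]]|no] := pselect (exists x, open_disc x /\ S' (act g (Q i x))).
    rewrite (_ : mkset _ = [set x]).
      apply: accessible_closed_set1; apply: hausdorff_accessible.
      exact: hausdorff_rV.
    by apply/seteqP; split=> [z [zD Sz]|z ->] //; exact: S'1.
  rewrite (_ : mkset _ = set0); first exact: closed0.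
  by apply/seteqP; split=> z // Sz; case: no; exists z.
exists ((fun y => closed_cell (c y).1 (c y).2) @` (f @` K)); split.
- exact: finite_image.
- move=> y Ky; have [fy _] := fP y Ky.
  exists (closed_cell (c (f y)).1 (c (f y)).2); first by exists (f y) => //; exists y.
  apply: open_cell_closed_cell; rewrite -/(cell (f y)) (cell_eq _ _ _ fy).
  exact: cP.
- move=> _ [_ [y Ky <-] <-]; exists (c (f y)).1, (c (f y)).2; split=> //.
  by exists (f y); split; [exact: cP | case: (fP y Ky)].
Qed.

(** Closure-finiteness: the boundary of a cell is compact, and it misses the open
   cells of dimension at least [d i]. *)
Lemma boundary_finite_cells g i :
  exists T : set (set E), [/\ finite_set T,
    forall x, sphere x -> (\bigcup_(A in T) A) (act g (Q i x)) &
    forall A, T A -> exists h j, A = closed_cell h j /\ (d j < d i)%N].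
Proof.
have cS : compact ((fun x => act g (Q i x)) @` @sphere R (d i)).
  apply: within_compact_image (@cell_within_continuous g i) _ _.
    exact: sphere_disc.
  exact: compact_sphere.
have [T [finT KT TP]] := compact_finite_cells cS.
exists T; split=> // [x xS|A /TP[h [j [-> [_ [[x xD <-] [z zS]]]]]]].
  by apply: KT; exists x.
have [k [l [w [dl wD ->]]]] := gc_bdry gcE zS.
rewrite -act_cellM => /(gc_inj gcE wD xD)[e _]; exists h, j; split=> //.
by have <- : l = j by case: e.
Qed.

(** ** From cells to skeleta *)

Definition cell_skel n : set E :=
  [set y | exists g i x, [/\ (d i < n)%N, open_disc x & y = act g (Q i x)]].

Lemma cell_skelS m n : (m <= n)%N -> cell_skel m `<=` cell_skel n.
Proof.
move=> mn y [g [i [x [dm xD ->]]]]; exists g, i, x; split=> //.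
exact: leq_trans dm mn.
Qed.

Lemma cell_skel_act n g y : cell_skel n y -> cell_skel n (act g y).
Proof.
by move=> [h [i [x [? ? ->]]]]; exists (g * h)%g, i, x; rewrite act_cellM.
Qed.

Lemma sphere_cell_skel g i x : sphere x -> cell_skel (d i) (act g (Q i x)).
Proof.
move=> xS; apply: cell_skel_act.
by have [h [j [z [? ? ->]]]] := gc_bdry gcE xS; exists h, j, z.
Qed.

Lemma disc_cell_skel g i x : disc x -> cell_skel (d i).+1 (act g (Q i x)).
Proof.
move=> /discE[/sphere_cell_skel xS|xD]; first exact: cell_skelS (xS g).
by exists g, i, x.
Qed.

Lemma open_cell_skel n g i x :
  open_disc x -> cell_skel n (act g (Q i x)) -> (d i < n)%N.
Proof.
move=> xD [h [j [z [dj zD /(gc_inj gcE xD zD)[e _]]]]].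
by have -> : i = j by case: e.
Qed.

(** A subset of [cell_skel n] meets a cell of dimension at least [n] in its
   boundary only, which is dealt with by [closed_cellwise]. *)
Lemma closed_in_cell_skel n (C : set E) : C `<=` cell_skel n ->
  (forall g i, (d i < n)%N -> closed [set x | disc x /\ C (act g (Q i x))]) ->
  closed C.
Proof.
move=> Cn cC; apply: closed_cellwise => g i cS.
have [din|nd] := ltnP (d i) n; first exact: cC.
rewrite (_ : mkset _ = [set x | sphere x /\ C (act g (Q i x))]) //.
apply/seteqP; split=> x [xD Cx]; split=> //; last exact: sphere_disc.
case/discE: xD => // xD; have := open_cell_skel xD (Cn _ Cx).
by rewrite ltnNge nd.
Qed.

Lemma closed_cell_skel n : closed (cell_skel n).
Proof.
apply: (@closed_in_cell_skel n) => // g i din.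
rewrite (_ : mkset _ = @disc R (d i)); first exact: closed_disc.
apply/seteqP; split=> [x []|x xD] //; split=> //.
exact: cell_skelS (disc_cell_skel g xD).
Qed.

(** As [cell_skel n] is closed, the subspace topologies in the definition of a
   pushout reduce to the topology of [E]. *)
Lemma cell_skel_attach n :
  attach_cells R act n (cell_skel n) (cell_skel n.+1).
Proof.
(* The cells are indexed by dimension there, so a point of [D^n] is transported
   along [d i = n]. *)
pose cast (i : I) (e : d i = n) (x : 'rV[R]_n) : 'rV[R]_(d i) :=
  eq_rect_r (fun m => 'rV[R]_m) x e.
have castD i m (e : d i = m) (x : 'rV[R]_m) :
    open_disc x -> open_disc (eq_rect_r (fun k => 'rV[R]_k) x e).
  by subst m.
exists {i : I | d i = n}, (fun i => H (sval i)),
  (fun i x => Q _ (cast (sval i) (proj2_sig i) x)); split.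
- by case=> i e; subst n; exact: (gc_continuous gcE).
- by case=> i e; subst n; exact: (gc_fixed gcE).
- by move=> g [i e]; subst n; exact: sphere_cell_skel.
- exact: cell_skelS.
- move=> y; split.
    move=> [[g [i [x [din xD ->]]]] nskel].
    have e : d i = n.
      apply/eqP; rewrite eqn_leq -ltnS din leqNgt; apply/negP => lt.
      by apply: nskel; exists g, i, x.
    by subst n; exists g, (exist (fun j => d j = d i) i erefl), x.
  move=> [g [[i e] [x [xD ->]]]]; subst n; rewrite /cast /=.
  split; first by exists g, i, x.
  by move=> /(open_cell_skel xD); rewrite ltnn.
- move=> g g' [i e] [i' e'] x x' xD x'D; subst n; rewrite /cast /= => eq.
  have x'D' := castD _ _ e' _ x'D.
  have [ee gg'] := gc_inj gcE xD x'D' eq.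
  have ei : i = i' by case: ee.
  subst i'; have e'1 : e' = erefl by exact: Prop_irrelevance.
  by subst e'; split=> //; exact: existT_inj ee.
- move=> C CB; rewrite -closed_setIS; last exact: closed_cell_skel.
  rewrite -closed_setIS; last exact: closed_cell_skel.
  rewrite (_ : C `&` cell_skel n.+1 = C); last exact/setIidPl.
  rewrite -setIA setIid; split.
    move=> cC; split; first by apply: closedI => //; exact: closed_cell_skel.
    by move=> g [i e]; subst n; exact: closed_trace.
  move=> [cA ct]; apply: closed_in_cell_skel CB _ => g i.
  rewrite ltnS leq_eqVlt => /orP[/eqP e|din].
    by subst n; exact: (ct g (exist (fun j => d j = d i) i erefl)).
  rewrite (_ : mkset _ =
    [set x | disc x /\ (C `&` cell_skel n) (act g (Q i x))]).
    exact: closed_trace.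
  apply/seteqP; split=> x [xD]; last by case.
  move=> Cx; split=> //; split=> //; apply: cell_skelS (disc_cell_skel g xD).
  exact: din.
Qed.

Lemma gcells_is_gcw : is_gcw R act.
Proof.
split; [exact: gc_action gcE | exact: gc_hausdorff gcE |].
exists cell_skel; split.
- by apply/seteqP; split=> y // [g [i [x []]]].
- exact: cell_skel_act.
- apply/seteqP; split=> y // _.
  have [g [i [x [xD ->]]]] := gc_cover gcE y; exists (d i).+1 => //.
  by exists g, i, x.
- exact: cell_skel_attach.
- move=> C; split=> [cC n|cC].
    by apply: closed_subspaceW; apply: closedI => //; exact: closed_cell_skel.
  apply: (gc_weak gcE) => g i.
  have := cC (d i).+1; rewrite -closed_setIS; last exact: closed_cell_skel.
  rewrite -setIA setIid => /(@closed_trace _ g i).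
  congr closed; apply/seteqP; split=> x [xD]; first by case.
  by move=> Cx; split=> //; split=> //; exact: disc_cell_skel.
Qed.

End Theory.


(** ** From skeleta to cells *)

Section OfSkeleta.
Context {E : topologicalType} {act : G -> E -> E}.
Context {I : nat -> Type} {H : forall n, I n -> groupClosed G}
  {Q : forall n, I n -> 'rV[R]_n -> E} {skel : nat -> set E}.
Arguments H : clear implicits.
Arguments Q : clear implicits.
Hypothesis actE : is_action act.
Hypothesis skel0 : skel 0%N = set0.
Hypothesis cellsE :
  forall n, pushout_cells act (skel n) (skel n.+1) (H n) (Q n).

Lemma skelS m n : (m <= n)%N -> skel m `<=` skel n.
Proof.
elim: n => [|n IHn]; first by rewrite leqn0 => /eqP ->.
rewrite leq_eqVlt => /orP[/eqP ->//|]; rewrite ltnS => /IHn mn.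
by apply: subset_trans mn _; exact: cell_sub (cellsE n).
Qed.

Lemma skel_in_cell n y : skel n y -> exists m g i x,
  [/\ (m < n)%N, open_disc x & y = act g (Q m i x)].
Proof.
elim: n => [|n IHn]; first by rewrite skel0.
move=> yn; have [/IHn[m [g [i [x [mn xD ->]]]]]|nyn] := pselect (skel n y).
  by exists m, g, i, x; split=> //; exact: leqW.
have [g [i [x [xD ->]]]] : exists g i x, open_disc x /\ y = act g (Q n i x).
  by apply/(cell_cover (cellsE n)).
by exists n, g, i, x.
Qed.

Lemma skel_open_cell n g i x : open_disc x ->
  skel n.+1 (act g (Q n i x)) /\ ~ skel n (act g (Q n i x)).
Proof.
by move=> xD; apply/(cell_cover (cellsE n)); exists g, i, x.
Qed.

Lemma skel_disc_cell n g i x : disc x -> skel n.+1 (act g (Q n i x)).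
Proof.
move=> /discE[xS|xD]; last by have [] := skel_open_cell g i xD.
by apply: (cell_sub (cellsE n)); exact: (cell_boundary (cellsE n)).
Qed.

(** The pushout squares give the weak topology of each skeleton, one dimension
   at a time. *)
Lemma closed_skel_trace n (C : set E) :
  (forall m g i, (m < n)%N -> closed [set x | disc x /\ C (act g (Q m i x))]) ->
  closed (C `&` skel n : set (subspace (skel n))).
Proof.
elim: n => [|n IHn] cC; first by rewrite skel0 setI0; exact: closed0.
have sub : C `&` skel n.+1 `<=` skel n.+1 by move=> y [].
apply/(cell_closed (cellsE n) sub); split.
  rewrite -setIA (setIidr (cell_sub (cellsE n))); apply: IHn => m g i mn.
  by apply: cC; exact: leqW.
move=> g i; have := cC n g i (ltnSn n).
congr closed; apply/seteqP; split=> x [xD]; last by case.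
by move=> Cx; split=> //; split=> //; exact: skel_disc_cell.
Qed.

End OfSkeleta.

Lemma is_gcw_gcells (E : topologicalType) (act : G -> E -> E) :
  is_gcw R act -> exists (I : Type) (d : I -> nat) (H : I -> groupClosed G)
    (Q : forall i, 'rV[R]_(d i) -> E), gcells act H Q.
Proof.
move=> [aE hE [skel [skel0 _ skelT att weak]]].
pose I n := projT1 (cid (att n)).
pose attI n := projT2 (cid (att n)).
pose H n := projT1 (cid (attI n)).
pose attH n := projT2 (cid (attI n)).
pose Q n := projT1 (cid (attH n)).
have cellsE n : pushout_cells act (skel n) (skel n.+1) (H n) (Q n).
  exact: projT2 (cid (attH n)).
have [a1 _ _] := aE.
exists {n & I n}, (@projT1 _ I), (fun p => H _ (projT2 p)),
  (fun p => Q _ (projT2 p)); split=> //=.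
- by case=> n i; exact: cell_continuous (cellsE n) i.
- by case=> n i; exact: cell_fixed (cellsE n) i.
- move=> y; have [n _ yn] : (\bigcup_n skel n) y by rewrite skelT.
  have [m [g [i [x [_ xD ->]]]]] := skel_in_cell skel0 cellsE yn.
  by exists g, (existT _ m i), x.
- move=> g g' [n i] [n' i'] /= x x' xD x'D eq.
  have [s1 s0] := skel_open_cell cellsE g i xD.
  have [s1' s0'] := skel_open_cell cellsE g' i' x'D.
  have en : n = n'.
    case: (ltngtP n n') => // lt.
      by case: s0'; rewrite -eq; exact: (skelS cellsE lt).
    by case: s0; rewrite eq; exact: (skelS cellsE lt).
  subst n'; have [ei gg' ->] := cell_inj (cellsE n) xD x'D eq.
  by subst i'.
- move=> [n i] x /= /(cell_boundary (cellsE n) 1%g i); rewrite a1.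
  move=> /(skel_in_cell skel0 cellsE)[m [g [j [z [mn zD ->]]]]].
  by exists g, (existT _ m j), z.
- move=> C cC; apply/weak => n; apply: (closed_skel_trace skel0 cellsE).
  by move=> m g i _; exact: (cC g (existT _ m i)).
- move=> C [n i] /= cC.
  have /closed_subspaceP[D cD eD] : closed (C `&` skel n : set (subspace (skel n))).
    apply: (closed_skel_trace skel0 cellsE) => m g j mn.
    exact: (cC g (existT _ m j)).
  have sn x : sphere x -> skel n (Q n i x).
    by move=> /(cell_boundary (cellsE n) 1%g i); rewrite a1.
  rewrite (_ : mkset _ = [set x | sphere x /\ D (Q n i x)]).
    apply: within_closed_preimage => //; first exact: closed_sphere.
    have := @cell_continuous _ _ _ _ _ _ _ _ _ _ (cellsE n) i.
    by apply: continuous_subspaceW; exact: sphere_disc.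
  apply/seteqP; split=> x [xS Cx]; split=> //.
    have : (C `&` skel n `&` skel n) (Q n i x).
      by split; [split=> // |]; exact: sn.
    by rewrite -eD => -[].
  have : (D `&` skel n) (Q n i x) by split=> //; exact: sn.
  by rewrite eD => -[[]].
Qed.

End GCells.

Arguments open_cell {R G E} act {I d} Q g i.
Arguments closed_cell {R G E} act {I d} Q g i.

(** * Disjoint unions and induced spaces *)

Lemma sigT_closedP (J : choiceType) (X : J -> topologicalType)
    (C : set {j & X j}) :
  closed C <-> forall j, closed (existT X j @^-1` C).
Proof.
rewrite -openC sigT_openP; split=> oC j; first by rewrite -openC; exact: oC.
by rewrite preimage_setC openC.
Qed.

Section Coproduct.
Context {R : realType} {G : groupType} {J : choiceType}
  {E : J -> topologicalType} {act : forall j, G -> E j -> E j}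
  {I : J -> Type} {d : forall j, I j -> nat}
  {H : forall j, I j -> groupClosed G}
  {Q : forall j i, 'rV[R]_(d j i) -> E j}.
Arguments act : clear implicits.
Arguments d : clear implicits.
Arguments H : clear implicits.
Arguments Q : clear implicits.
Hypothesis gcE : forall j, gcells (act j) (H j) (Q j).

Lemma coprod_is_action : is_action (coprod_act act).
Proof.
split.
- move=> [j x]; rewrite /coprod_act /=; congr existT.
  by have [a1 _ _] := gc_action (gcE j).
- move=> g h [j x]; rewrite /coprod_act /=; congr existT.
  by have [_ aM _] := gc_action (gcE j).
- move=> g; apply: (@sigT_continuous _ _ _ (fun j x => existT E j (act j g x))).
  move=> j x; apply: continuous_comp; last exact: existT_continuous.
  by have [_ _] := gc_action (gcE j); apply.
Qed.

Lemma coprod_gcells : gcells (coprod_act act)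
  (fun p : {j & I j} => H _ (projT2 p))
  (fun (p : {j & I j}) (x : 'rV[R]_(d _ (projT2 p))) =>
     existT E _ (Q _ _ x)).
Proof.
split=> /=.
- exact: coprod_is_action.
- by apply: sigT_hausdorff => j; exact: gc_hausdorff (gcE j).
- move=> [j i] /=; apply: (continuous_comp_within (gc_continuous (gcE j) (i := i))).
  exact: existT_continuous.
- move=> [j i] x /= xD h hH; rewrite /coprod_act /=; congr existT.
  exact: (gc_fixed (gcE j) xD hH).
- move=> [j y]; have [g [i [x [xD ->]]]] := gc_cover (gcE j) y.
  by exists g, (existT _ j i), x.
- move=> g g' [j i] [j' i'] /= x x' xD x'D eq.
  have ej : j = j' by case: eq.
  subst j'; have [e gg'] := gc_inj (gcE j) xD x'D (existT_inj eq).
  split=> //; have ei : i = i' by case: e.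
  by subst i'; rewrite (existT_inj e).
- move=> [j i] x /= /(gc_bdry (gcE j))[g [i' [x' [di x'D ->]]]].
  by exists g, (existT _ j i'), x'.
- move=> C cC; apply/sigT_closedP => j; apply: (gc_weak (gcE j)) => g i.
  exact: (cC g (existT _ j i)).
- move=> C [j i] /= cC.
  apply: (gc_bdry_weak (gcE j) (C := existT E j @^-1` C)) => g i' di.
  exact: (cC g (existT _ j i')).
Qed.

End Coproduct.

Section Subgroups.
Context {G : groupType}.

Lemma mem_conjsg (g : G) (H : groupClosed G) x :
  (x \in conjsg g H) = ((x ^ g)%g \in H).
Proof. by []. Qed.

Lemma mem_capg (H K : groupClosed G) x :
  (x \in capg H K) = (x \in H) && (x \in K).
Proof. by []. Qed.

Context {L : groupClosed G}.

(** The subgroup [r K r^-1] of [G], for [K] a subgroup of [L]. *)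
Definition conj_incl_pred (r : G) (K : groupClosed (subgroup_type L)) :
    {pred G} :=
  [pred g | `[< exists2 k : subgroup_type L, k \in K & (g ^ r)%g = val k >]].

Fact conj_incl_invr r K : invg_closed (conj_incl_pred r K).
Proof.
move=> x /asboolP[k kK e]; apply/asboolP; exists (k^-1)%g.
  exact: gpredVr.
by rewrite conjVg e.
Qed.

Fact conj_incl_1 r K : 1%g \in conj_incl_pred r K.
Proof.
by apply/asboolP; exists 1%g; [exact: gpred1 | rewrite conj1g].
Qed.

Fact conj_incl_mul r K : mulg_closed (conj_incl_pred r K).
Proof.
move=> x y /asboolP[k kK ek] /asboolP[l lK el]; apply/asboolP.
by exists (k * l)%g; [exact: gpredM | rewrite conjMg ek el].
Qed.

Definition conj_incl r K : groupClosed G :=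
  HB.pack_for (groupClosed G) (conj_incl_pred r K)
    (isInvClosed.Build G (conj_incl_pred r K) (@conj_incl_invr r K))
    (isMul1Closed.Build G (conj_incl_pred r K) (@conj_incl_1 r K))
    (isMulClosed.Build G (conj_incl_pred r K) (@conj_incl_mul r K)).

Lemma conj_inclP r (K : groupClosed (subgroup_type L)) g :
  reflect (exists2 k : subgroup_type L, k \in K & (g ^ r)%g = val k) (g \in conj_incl r K).
Proof. exact: asboolP. Qed.

End Subgroups.

Section Cosets.
Context {G : groupType} {L : groupClosed G}.
Implicit Types (g : G) (A B : lcosets L).

Lemma lcosetsP A g : val A g -> val A = lcoset_set L g.
Proof.
case: A => A /= /set_mem[a _ <-] ag; apply/seteqP.
rewrite /lcoset_set /= in ag *; split=> x /= ax.
  rewrite (_ : (g^-1 * x = (a^-1 * g)^-1 * (a^-1 * x))%g); last first.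
    by rewrite invgM invgK mulgA mulgK.
  by apply: gpredM => //; exact: gpredVr.
rewrite (_ : (a^-1 * x = (a^-1 * g) * (g^-1 * x))%g); last first.
  by rewrite -mulgA mulVKg.
exact: gpredM.
Qed.

Lemma lcosets_eq A B g : val A g -> val B g -> A = B.
Proof. by move=> /lcosetsP Ag /lcosetsP Bg; apply: val_inj; rewrite Ag Bg. Qed.

Lemma lcosets_div A g h : val A g -> val A h -> (g^-1 * h)%g \in L.
Proof. by move=> /lcosetsP -> . Qed.

Lemma mem_lcoset_act g A x : val (lcoset_act g A) (g * x)%g = val A x.
Proof. by rewrite /= mulKg. Qed.

Lemma lcoset_act1 A : lcoset_act 1%g A = A.
Proof.
apply: val_inj => /=; apply/seteqP.
by split=> x /=; rewrite invg1 mul1g.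
Qed.

Lemma lcoset_actM g h A : lcoset_act (g * h)%g A = lcoset_act g (lcoset_act h A).
Proof.
apply: val_inj => /=; apply/seteqP.
by split=> x /=; rewrite invgM mulgA.
Qed.

Definition lcoset1 : lcosets L :=
  exist _ (lcoset_set L 1%g) (mem_set (imageT (lcoset_set L) 1%g)).

End Cosets.

Section Induced.
Context {R : realType} {G : groupType} {L : groupClosed G}
  {E : topologicalType} {act : subgroup_type L -> E -> E}
  (r : coset_repr L)
  {I : Type} {d : I -> nat} {H : I -> groupClosed (subgroup_type L)}
  {Q : forall i, 'rV[R]_(d i) -> E}.
Arguments Q : clear implicits.
Hypothesis gcE : gcells act H Q.

Lemma induced_is_action : is_action (induced_act act r).
Proof.
have [a1 aM ac] := gc_action gcE; split.
- move=> [A x]; rewrite /induced_act /= lcoset_act1; congr existT.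
  rewrite -[RHS]a1; congr act; apply: val_inj => /=.
  by rewrite lcoset_act1 mulg1 mulVg.
- move=> g h [A x]; rewrite /induced_act /= -aM lcoset_actM; congr existT.
  congr act; apply: val_inj => /=.
  by rewrite lcoset_actM -!mulgA mulVKg.
- move=> g; apply: (@sigT_continuous _ _ _ (fun A x => 
    existT (fun=> E) (lcoset_act g A) (act (coset_cocycle r g A) x))).
  move=> A x; apply: continuous_comp; last exact: existT_continuous.
  exact: ac.
Qed.

(** Every point of the induced space is moved from the copy of [E] over the coset
   of 1, by an element that also realizes any prescribed translation by [L]. *)
Lemma induced_act_from1 A l (x : E) :
  induced_act act r (r A * val l * (r lcoset1)^-1)%g (existT _ lcoset1 x) =
  existT _ A (act l x).
Proof.
set g := (_ * _ * _)%g.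
have eA : lcoset_act g lcoset1 = A.
  apply: (@lcosets_eq _ _ _ _ (g * (r lcoset1 * (val l)^-1)))%g.
    rewrite mem_lcoset_act /= /lcoset_set /= invg1 mul1g.
    apply: gpredM; last by apply: gpredVr; exact: valP.
    have := coset_reprP r lcoset1.
    by rewrite /= /lcoset_set /= invg1 mul1g.
  by rewrite /g !mulgA mulgVK mulgK; exact: coset_reprP.
rewrite /induced_act /= eA; congr existT; congr act; apply: val_inj => /=.
by rewrite eA /g !mulgA mulVg mul1g mulgVK.
Qed.

(** The cells of [E], placed over the coset of 1, represent all the cells of the
   induced space; their stabilizers are conjugated by the representative [r lcoset1],
   which need not be 1. *)
Lemma induced_gcells : gcells (induced_act act r)
  (fun i => conj_incl (r lcoset1) (H i))
  (fun i (x : 'rV[R]_(d i)) => existT _ lcoset1 (Q i x) : induced_space L E).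
Proof.
split.
- exact: induced_is_action.
- apply: (@sigT_hausdorff (lcosets L) (fun=> E)) => _.
  exact: gc_hausdorff gcE.
- move=> i; apply: (continuous_comp_within (gc_continuous gcE (i := i))).
  exact: (@existT_continuous (lcosets L) (fun=> E)).
- move=> i x xD h /conj_inclP[k kH hr].
  have -> : h = (r lcoset1 * val k * (r lcoset1)^-1)%g.
    by rewrite -hr conjgE !mulgA mulgV mul1g mulgK.
  by rewrite induced_act_from1 (gc_fixed gcE xD).
- move=> [A y]; have [l [i [x [xD ->]]]] := gc_cover gcE y.
  exists (r A * val l * (r lcoset1)^-1)%g, i, x; split=> //.
  by rewrite induced_act_from1.
- move=> g g' i i' x x' xD x'D eq.
  have e1 : lcoset_act g (@lcoset1 _ L) = lcoset_act g' lcoset1.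
    exact: (congr1 (fun p : induced_space L E => projT1 p) eq).
  have /(gc_inj gcE xD x'D)[e cc'] :=
    congr1 (fun p : induced_space L E => projT2 p) eq.
  split=> //; apply/conj_inclP; eexists; first exact: cc'.
  by rewrite /= e1 !invgM invgK conjgE -!mulgA mulVKg.
- move=> i x /(gc_bdry gcE)[l [i' [x' [di x'D ->]]]].
  exists (r lcoset1 * val l * (r lcoset1)^-1)%g, i', x'; split=> //.
  by rewrite induced_act_from1.
- move=> C cC; apply/(@sigT_closedP (lcosets L) (fun=> E)) => A.
  apply: (gc_weak gcE) => l i.
  have := cC (r A * val l * (r lcoset1)^-1)%g i.
  by under eq_set do rewrite induced_act_from1.
- move=> C i cC.
  apply: (gc_bdry_weak gcE (C := existT (fun=> E) lcoset1 @^-1` C)) => l i' di.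
  have := cC (r lcoset1 * val l * (r lcoset1)^-1)%g i' di.
  by under eq_set do rewrite induced_act_from1.
Qed.

End Induced.

(** * The topology of the join *)

Section JoinTopology.
Context {R : realType} {X Y : topologicalType}.
Implicit Types (x : X) (t : R) (y : Y).

(** The quotient map [X × [0, 1] × Y -> X * Y], as a function on [X × R × Y]; in
   this form [t] can be computed with in [R].  It is meant to be used on [slab]. *)
Definition jpt (p : X * R * Y) : join R X Y :=
  if insub p.1.2 is Some t then join_mid p.1.1 t p.2
  else if p.1.2 == 0 then @join_inl R X Y p.1.1 else @join_inr R X Y p.2.

Definition slab : set (X * R * Y) := [set p | 0 <= p.1.2 <= 1].

Lemma jpt0 x y : jpt (x, 0, y) = @join_inl R X Y x.
Proof. by rewrite /jpt insubF ?eqxx //= ltxx. Qed.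

Lemma jpt1 x y : jpt (x, 1, y) = @join_inr R X Y y.
Proof. by rewrite /jpt insubF /= ?oner_eq0 // ltxx andbF. Qed.

Lemma jpt_eq0 p : p.1.2 = 0 -> jpt p = join_inl R Y p.1.1.
Proof. by case: p => [[x t] y] /= ->; exact: jpt0. Qed.

Lemma jpt_eq1 p : p.1.2 = 1 -> jpt p = join_inr R X p.2.
Proof. by case: p => [[x t] y] /= ->; exact: jpt1. Qed.

Lemma jpt_mid x (t : {t : R | 0 < t < 1}) y :
  jpt (x, val t, y) = join_mid x t y.
Proof. by rewrite /jpt /= valK. Qed.

Lemma jpt_midE x t y (t01 : 0 < t < 1) :
  jpt (x, t, y) = join_mid x (exist _ t t01) y.
Proof. by rewrite -jpt_mid. Qed.

Local Notation I01 := (`[0, 1]%classic : set R).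

Fact clip_subproof t : Num.max 0 (Num.min 1 t) \in I01.
Proof.
by apply/mem_set; rewrite /= in_itv /= le_max lexx ge_max ler01 ge_min lexx.
Qed.

Definition clip t : I01 := exist (fun u => u \in I01) _ (clip_subproof t).

Lemma clip_continuous : continuous clip.
Proof.
apply: continuous_comp_initial => t; apply: (@continuous_max _ _ (cst 0)).
  exact: cst_continuous.
apply: (@continuous_min _ _ (cst 1) id) => //; exact: cst_continuous.
Qed.

Lemma val_clip t : 0 <= t <= 1 -> val (clip t) = t.
Proof. by move=> /andP[t0 t1] /=; rewrite (min_idPr t1) (max_idPr t0). Qed.

(** The topology of the join, with the compactly generated topology replaced by
   traces on the compact subsets of [slab], on which [clip] is a retraction. *)
Lemma closed_joinP (C : set (join R X Y)) :
  hausdorff_space X -> hausdorff_space Y ->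
  closed C <-> [/\ closed (@join_inl R X Y @^-1` C), closed (@join_inr R X Y @^-1` C) &
    forall K, compact K -> K `<=` slab -> closed (K `&` jpt @^-1` C)].
Proof.
move=> hX hY.
have hXRY : hausdorff_space (X * R * Y)%type.
  by apply: hausdorff_prod => //; apply: hausdorff_prod => //; exact: Rhausdorff.
have piE (x : X) (t : I01) (y : Y) : join_pi (x, t, y) = jpt (x, val t, y).
  by [].
rewrite -openC; split.
  move=> [oX oY oK]; split; [by rewrite -openC | by rewrite -openC |].
  move=> K cK Kslab.
  pose lam (p : X * R * Y) : X * I01 * Y := (p.1.1, clip p.1.2, p.2).
  have lamc : continuous lam.
    apply: pair_continuous; last exact: snd_continuous.
    apply: pair_continuous.
      by apply: (comp_continuous fst_continuous); exact: fst_continuous.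
    apply: comp_continuous clip_continuous.
    by apply: (comp_continuous fst_continuous); exact: snd_continuous.
  have := oK (lam @` K) (continuous_compact (continuous_subspaceT lamc) cK).
  rewrite open_subspaceIT preimage_setC openC => /closed_subspaceP[D cD eD].
  rewrite (_ : _ `&` _ = [set p | K p /\ D (lam p)]).
    apply: within_closed_preimage cD; first exact: compact_closed.
    exact: continuous_subspaceT.
  have Klam p : K p -> join_pi (lam p) = jpt p.
    by move: p => [[x t] y] /Kslab xty; rewrite piE val_clip.
  apply/seteqP; split=> p [Kp Cp]; split=> //.
    have : (@join_pi R X Y @^-1` C `&` lam @` K) (lam p).
      split; last by exists p.
      by change (C (join_pi (lam p))); rewrite Klam.
    by rewrite -eD => -[].
  have : (D `&` lam @` K) (lam p) by split=> //; exists p.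
  rewrite eD => -[Clam _]; change (C (jpt p)).
  by rewrite -Klam.
move=> [cX cY cK]; split; [by rewrite preimage_setC openC.. |].
move=> K cptK; rewrite open_subspaceIT preimage_setC openC.
pose inc (p : X * I01 * Y) : X * R * Y := (p.1.1, val p.1.2, p.2).
have incc : continuous inc.
  apply: pair_continuous; last exact: snd_continuous.
  apply: pair_continuous.
    by apply: (comp_continuous fst_continuous); exact: fst_continuous.
  apply: (comp_continuous (comp_continuous fst_continuous snd_continuous)).
  exact: initial_continuous.
apply/closed_subspaceP; exists (inc @^-1` (inc @` K `&` jpt @^-1` C)).
  apply: (preimage_closed (fun p _ => incc p)); apply: cK.
    exact: (continuous_compact (continuous_subspaceT incc) cptK).
  by move=> _ [[[x t] y] _ <-]; have := set_mem (valP t); rewrite /= in_itv.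
apply/seteqP; split=> p; case: p => [[x t] y].
  by move=> [[_ ?] ?].
by move=> [? Kp]; split=> //; split=> //; exists (x, t, y).
Qed.

Hypothesis hX : hausdorff_space X.
Hypothesis hY : hausdorff_space Y.

Lemma join_inl_continuous : continuous (@join_inl R X Y : X -> join R X Y).
Proof. by apply/continuous_closedP => C /(closed_joinP _ hX hY)[]. Qed.

Lemma join_inr_continuous : continuous (@join_inr R X Y : Y -> join R X Y).
Proof. by apply/continuous_closedP => C /(closed_joinP _ hX hY)[]. Qed.

(** [jpt] is continuous for the compactly generated topology only; a map with
   compact source [A] does not see the difference, as its image is compact. *)
Lemma jpt_within_continuous (T : topologicalType) (A : set T)
    (f : T -> X * R * Y) :
  hausdorff_space T -> compact A -> {within A, continuous f} ->
  (forall a, A a -> slab (f a)) -> {within A, continuous (jpt \o f)}.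
Proof.
move=> hT cA fA fslab; apply: closed_within_continuous => C.
move=> /(closed_joinP _ hX hY)[_ _ cC].
have clK : closed (f @` A `&` jpt @^-1` C).
  by apply: cC; [exact: continuous_compact | move=> _ [a /fslab ? <-]].
rewrite (_ : mkset _ = [set a | A a /\ (f @` A `&` jpt @^-1` C) (f a)]).
  by apply: within_closed_preimage => //; exact: compact_closed.
apply/seteqP; split=> a [Aa]; last by case.
by move=> Ca; split=> //; split=> //; exists a.
Qed.

Lemma closed_join_inr (C : set Y) : closed C -> closed (@join_inr R X Y @` C).
Proof.
move=> cC; apply/(closed_joinP _ hX hY); split.
- rewrite (_ : _ @^-1` _ = set0); first exact: closed0.
  by apply/seteqP; split=> x // [].
- rewrite (_ : _ @^-1` _ = C) //.
  by apply/seteqP; split=> [y [z Cz [<-]] // | y Cy]; exists y.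
- move=> K cK Kslab; rewrite (_ : _ `&` _ = 
    K `&` [set p | p.1.2 = 1] `&` [set p | C p.2]).
    apply: closedI; last first.
      by apply: (preimage_closed (f := snd) _ cC) => p _; exact: cvg_snd.
    apply: closedI.
      apply: compact_closed cK; apply: hausdorff_prod => //.
      by apply: hausdorff_prod => //; exact: Rhausdorff.
    apply: (preimage_closed (f := fun p : X * R * Y => p.1.2) _ (closed_eq (y:=1))).
    by move=> p _; exact: (comp_continuous fst_continuous snd_continuous).
  apply/seteqP; split=> -[[x t] y] /=.
    move=> [Kp]; move: (Kslab _ Kp); rewrite /slab /= => /andP[].
    rewrite le_eqVlt => /orP[/eqP <-|t0]; first by rewrite jpt0 => _ [z _] //.
    rewrite le_eqVlt => /orP[/eqP t1|t1]; last first.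
      have t01 : 0 < t < 1 by rewrite t0.
      by rewrite (jpt_midE _ _ t01) => -[z _] //.
    by move: Kp; rewrite t1 jpt1 => Kp [z Cz [zy]]; rewrite zy in Cz.
  by move=> [[Kp e] Cy]; split=> //; rewrite e jpt1; exists y.
Qed.

(** The parameter [t] is continuous on the join: it separates points with distinct
   parameters.  Those with equal parameters have distinct coordinates in [X] or in
   [Y], and are separated by sets of the form [join_left U] or [join_right U]. *)
Let jparam (p : join R X Y) : R :=
  match p with join_inl _ => 0 | join_mid _ t _ => val t | join_inr _ => 1 end.

Lemma open_kspace (T : topologicalType) (U : set T) :
  open U -> open (U : set (kspace T)).
Proof.
move=> oU; change (kopen U) => K _.
by rewrite open_subspaceIT; exact: open_subspaceW.
Qed.

Let jparam_pi p : jparam (join_pi p) = val p.1.2.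
Proof.
case: p => [[x t] y]; rewrite /join_pi; case: insubP => [u _ <- //|].
have /andP[t0 t1] : 0 <= val t <= 1 by have := set_mem (valP t); rewrite /= in_itv.
have [-> //|tn0] := eqVneq (val t) 0.
rewrite lt_neqAle eq_sym tn0 t0 /= => tn1 /=.
by apply/eqP; rewrite eq_sym eq_le t1 leNgt tn1.
Qed.

Let pi_snd_continuous :
  continuous (fun p : X * I01 * Y => val p.1.2 : R).
Proof.
apply: (comp_continuous (comp_continuous fst_continuous snd_continuous)).
exact: initial_continuous.
Qed.

Lemma jparam_continuous : continuous jparam.
Proof.
have open_cst (T : topologicalType) (P : Prop) : open [set _ : T | P].
  have [p|np] := pselect P.
    by rewrite (_ : mkset _ = setT); [exact: openT | apply/seteqP; split].
  by rewrite (_ : mkset _ = set0); [exact: open0 | apply/seteqP; split].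
apply/continuousP => U oU; split.
- rewrite (_ : _ @^-1` _ = [set x | U 0]) //.
- rewrite (_ : _ @^-1` _ = [set y | U 1]) //.
- apply: open_kspace; rewrite (_ : _ @^-1` _ =
    (fun p : X * I01 * Y => val p.1.2 : R) @^-1` U).
    exact: ((continuousP _).1 pi_snd_continuous _ oU).
  by apply/seteqP; split=> p /=; rewrite jparam_pi.
Qed.

Definition join_left (U : set X) : set (join R X Y) := [set p | match p with
    join_inl x | join_mid x _ _ => U x | join_inr _ => False end].

Definition join_right (U : set Y) : set (join R X Y) := [set p | match p with
    join_inr y | join_mid _ _ y => U y | join_inl _ => False end].

Lemma open_join_left (U : set X) : open U ->
  open (join_left U).
Proof.
move=> oU; split=> //.
- rewrite (_ : _ @^-1` _ = set0); first exact: open0.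
  by apply/seteqP; split.
- apply: open_kspace; rewrite (_ : _ @^-1` _ =
    (fun p : X * I01 * Y => p.1.1) @^-1` U `&` 
    (fun p : X * I01 * Y => val p.1.2 : R) @^-1` [set t | t < 1]).
    apply: openI.
      apply: ((continuousP _).1 _ _ oU).
      exact: (comp_continuous fst_continuous fst_continuous).
    exact: ((continuousP _).1 pi_snd_continuous _ (open_lt (y:=1))).
  apply/seteqP; split=> p /=; rewrite -jparam_pi;
    case: p => [[x t] y]; rewrite /join_pi.
    case: insubP => [u _ _ /=|_]; first by case/andP: (valP u).
    by case: eqP => //= _; rewrite ltr01.
  case: insubP => [u _ _ /= []//|_].
  by case: eqP => /= _ [] //; rewrite ltxx.
Qed.

Lemma open_join_right (U : set Y) : open U ->
  open (join_right U).
Proof.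
move=> oU; split=> //.
- rewrite (_ : _ @^-1` _ = set0); first exact: open0.
  by apply/seteqP; split.
- apply: open_kspace; rewrite (_ : _ @^-1` _ =
    (fun p : X * I01 * Y => p.2) @^-1` U `&` 
    (fun p : X * I01 * Y => val p.1.2 : R) @^-1` [set t | 0 < t]).
    apply: openI.
      by apply: ((continuousP _).1 _ _ oU); exact: snd_continuous.
    exact: ((continuousP _).1 pi_snd_continuous _ (open_gt (y:=0))).
  apply/seteqP; split=> p /=; rewrite -jparam_pi;
    case: p => [[x t] y]; rewrite /join_pi.
    case: insubP => [u _ _ /=|_]; first by case/andP: (valP u).
    by case: eqP => //= _; rewrite ltr01.
  case: insubP => [u _ _ /= []//|_].
  by case: eqP => /= _ [] //; rewrite ltxx.
Qed.

Lemma hausdorff_join : hausdorff_space (join R X Y).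
Proof.
rewrite open_hausdorff => p q pq.
have sep (T : topologicalType) (f : set T -> set (join R X Y)) a b :
    hausdorff_space T -> (forall U, open U -> open (f U)) ->
    (forall U V, U `&` V = set0 -> f U `&` f V = set0) ->
    (forall U, U a -> f U p) -> (forall U, U b -> f U q) -> a != b ->
    exists2 AB, (p \in AB.1 /\ q \in AB.2) &
      [/\ open AB.1, open AB.2 & AB.1 `&` AB.2 == set0].
  rewrite open_hausdorff => hT fo fI fa fb /hT[[A B] [/=]].
  move=> /set_mem Aa /set_mem Bb [oA oB /eqP AB].
  exists (f A, f B); first by split; apply/mem_set; [exact: fa | exact: fb].
  by split=> /=; [exact: fo | exact: fo | apply/eqP; exact: fI].
have [|] := eqVneq (jparam p) (jparam q); last first.
  apply: (sep R (fun U => jparam @^-1` U) _ _ (@Rhausdorff R)) => //.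
    by move=> U; exact: ((continuousP _).1 jparam_continuous U).
  by move=> U V UV; rewrite -preimage_setI UV preimage_set0.
have IX (U V : set X) :
    U `&` V = set0 -> join_left U `&` join_left V = set0.
  move=> UV; apply/seteqP; split=> -[x|x t y|y] // [Ux Vx] //;
    by have : (U `&` V) x by []; rewrite UV.
have IY (U V : set Y) :
    U `&` V = set0 -> join_right U `&` join_right V = set0.
  move=> UV; apply/seteqP; split=> -[x|x t y|y] // [Ux Vx] //;
    by have : (U `&` V) y by []; rewrite UV.
have sepX x x' : (forall U, U x -> join_left U p) ->
    (forall U, U x' -> join_left U q) -> x != x' -> _ :=
  sep X _ x x' hX open_join_left IX.
have sepY y y' : (forall U, U y -> join_right U p) ->
    (forall U, U y' -> join_right U q) -> y != y' -> _ :=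
  sep Y _ y y' hY open_join_right IY.
have mid01 (t : {t : R | 0 < t < 1}) : (sval t != 0) && (sval t != 1).
  by have /andP[t0 t1] := valP t; rewrite gt_eqF //= lt_eqF.
move: p q {sep} => [x|x t y|y] [x'|x' t' y'|y'] /= in pq sepX sepY * => e.
- by apply: (sepX x x') => //; apply: contra pq => /eqP ->.
- by have := mid01 t'; rewrite -e eqxx.
- by have := @oner_eq0 R; rewrite -e eqxx.
- by have := mid01 t; rewrite e eqxx.
- have {}e : t = t' by exact: val_inj.
  subst t'; have [ex|] := eqVneq x x'; last exact: (sepX x x').
  apply: (sepY y y') => //; apply: contra pq => /eqP ->.
  by rewrite ex.
- by have := mid01 t; rewrite e eqxx andbF.
- by have := @oner_eq0 R; rewrite e eqxx.
- by have := mid01 t'; rewrite -e eqxx andbF.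
- by apply: (sepY y y') => //; apply: contra pq => /eqP ->.
Qed.

End JoinTopology.

(** * Products of discs are discs *)

Section CellProduct.
Context {R : realType}.

Lemma cvg_mx (T : topologicalType) m n (f : T -> 'M[R]_(m, n))
    (x : T) (M : 'M[R]_(m, n)) :
  (forall i j, (fun z => f z i j) @ x --> M i j) -> f @ x --> M.
Proof.
move=> fM; have FF := nbhs_filter x; apply/cvg_ballP => e e0.
have := @filter_forall _ _ (fun ij z => ball (M ij.1 ij.2) e (f z ij.1 ij.2)) _ FF.
have fb (ij : 'I_m * 'I_n) : \forall z \near x, ball (M ij.1 ij.2) e (f z ij.1 ij.2).
  by have /cvg_ballP := fM ij.1 ij.2; apply.
by move=> /(_ fb); apply: filterS => z fz; split=> // i j; exact: (fz (i, j)).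
Qed.

Lemma mx_continuous (T : topologicalType) m n (f : T -> 'M[R]_(m, n)) :
  (forall i j, continuous (fun z => f z i j)) -> continuous f.
Proof. by move=> fc x; apply: cvg_mx => i j; exact: fc. Qed.

Lemma lsubmx_continuous m n : continuous (fun x : 'rV[R]_(m + n) => lsubmx x).
Proof.
apply: mx_continuous => i j.
rewrite (_ : (fun x => _) = (fun x : 'rV[R]_(m + n) => x i (lshift n j))).
  exact: coord_continuous.
by apply: funext => x; rewrite mxE.
Qed.

Lemma rsubmx_continuous m n : continuous (fun x : 'rV[R]_(m + n) => rsubmx x).
Proof.
apply: mx_continuous => i j.
rewrite (_ : (fun x => _) = (fun x : 'rV[R]_(m + n) => x i (rshift m j))).
  exact: coord_continuous.
by apply: funext => x; rewrite mxE.
Qed.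

Lemma maxr_continuous (T : topologicalType) (f g : T -> R) :
  continuous f -> continuous g -> continuous (fun x => Num.max (f x) (g x)).
Proof.
by move=> fc gc x; apply: (@continuous_max _ _ f g); [exact: fc | exact: gc].
Qed.

Lemma mulr_continuous_at (T : topologicalType) (f g : T -> R) (x : T) :
  f @ x --> f x -> g @ x --> g x ->
  (fun z => f z * g z) @ x --> f x * g x.
Proof. exact: cvgM. Qed.

Lemma divr_continuous_at (T : topologicalType) (f g : T -> R) (x : T) :
  g x != 0 -> f @ x --> f x -> g @ x --> g x ->
  (fun z => f z / g z) @ x --> f x / g x.
Proof. by move=> gx fc gc; apply: cvgM => //; exact: cvgV. Qed.

Lemma cvg0_normr_le (T : topologicalType) (f g : T -> R) (x : T) :
  (forall z, `|f z| <= g z) -> g @ x --> 0 -> f @ x --> 0.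
Proof.
move=> fg g0; apply/norm_cvg0P.
apply: (@squeeze_cvgr _ _ _ _ (cst 0) g) => //; last exact: cvg_cst.
by apply: nearW => z; rewrite /= normr_ge0 fg.
Qed.

Lemma sqnormZ n k (x : 'rV[R]_n) : sqnorm (k *: x) = k ^+ 2 * sqnorm x.
Proof. by rewrite /sqnorm mulr_sumr; apply: eq_bigr => i _; rewrite mxE exprMn. Qed.

Lemma sqnorm_eq0 n (x : 'rV[R]_n) : sqnorm x = 0 -> x = 0.
Proof.
move=> /eqP; rewrite psumr_eq0 => [/allP x0|i _]; last exact: sqr_ge0.
apply/rowP => i; rewrite mxE; apply/eqP; rewrite -sqrf_eq0; apply: x0.
exact: mem_index_enum.
Qed.

Lemma sqnorm0 n : sqnorm (0 : 'rV[R]_n) = 0.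
Proof. by rewrite /sqnorm big1 // => i _; rewrite mxE expr0n. Qed.

Lemma sqr_coord_le n (x : 'rV[R]_n) i : x 0 i ^+ 2 <= sqnorm x.
Proof.
by rewrite /sqnorm (bigD1 i) //= lerDl; apply: sumr_ge0 => j _; exact: sqr_ge0.
Qed.

Lemma sqnorm_row m n (x : 'rV[R]_(m + n)) :
  sqnorm x = sqnorm (lsubmx x) + sqnorm (rsubmx x).
Proof.
rewrite /sqnorm big_split_ord.
by congr (_ + _); apply: eq_bigr => i _; rewrite mxE.
Qed.

Lemma sqnorm_gt0 n (u : 'rV[R]_n) : u != 0 -> 0 < sqnorm u.
Proof.
move=> u0; rewrite lt_neqAle sqnorm_ge0 andbT eq_sym.
by apply: contra u0 => /eqP/sqnorm_eq0 ->.
Qed.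

Variables m n : nat.
Notation V := ('rV[R]_(m + (1 + n))).
Implicit Types u v w : V.

(** The square of the norm on [V] whose unit ball is the product of the unit
   discs of dimensions [m], [1] and [n]. *)
Definition boxnorm (u : V) : R :=
  Num.max (Num.max (sqnorm (lsubmx u)) (sqnorm (lsubmx (rsubmx u))))
    (sqnorm (rsubmx (rsubmx u))).

Lemma boxnormZ k u : boxnorm (k *: u) = k ^+ 2 * boxnorm u.
Proof.
by rewrite /boxnorm !linearZ /= !sqnormZ !maxr_pMr // sqr_ge0.
Qed.

Lemma boxnorm_ge0 u : 0 <= boxnorm u.
Proof. by rewrite /boxnorm !le_max !sqnorm_ge0. Qed.

Lemma sqnorm_le_boxnorm u : sqnorm u <= 3 * boxnorm u.
Proof.
have l1 : sqnorm (lsubmx u) <= boxnorm u by rewrite /boxnorm !le_max lexx.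
have l2 : sqnorm (lsubmx (rsubmx u)) <= boxnorm u.
  by rewrite /boxnorm !le_max lexx orbT.
have l3 : sqnorm (rsubmx (rsubmx u)) <= boxnorm u.
  by rewrite /boxnorm le_max lexx orbT.
rewrite sqnorm_row (sqnorm_row (rsubmx u)); lra.
Qed.

Lemma boxnorm_gt0 u : u != 0 -> 0 < boxnorm u.
Proof.
by move=> /sqnorm_gt0 u0; have := sqnorm_le_boxnorm u; lra.
Qed.

Lemma boxnorm_continuous : continuous boxnorm.
Proof.
have c1 := @lsubmx_continuous m (1 + n); have c2 := @rsubmx_continuous m (1 + n).
have c3 := @lsubmx_continuous 1 n; have c4 := @rsubmx_continuous 1 n.
apply: maxr_continuous; first apply: maxr_continuous.
- exact: (comp_continuous c1 (@sqnorm_continuous _ _)).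
- exact: (comp_continuous (comp_continuous c2 c3) (@sqnorm_continuous _ _)).
- exact: (comp_continuous (comp_continuous c2 c4) (@sqnorm_continuous _ _)).
Qed.

(** The radial homeomorphism from the Euclidean ball to the box.  Its value at
   [0] is [0], whatever the convention for [0 / 0]. *)
Definition round_to_box (u : V) : V :=
  Num.sqrt (sqnorm u / boxnorm u) *: u.

(** This identity is what makes [round_to_box] send the disc to the box, its
   interior to the interior, and its boundary to the boundary. *)
Lemma boxnorm_round_to_box u : boxnorm (round_to_box u) = sqnorm u.
Proof.
have [->|u0] := eqVneq u 0.
  by rewrite /round_to_box scaler0 /boxnorm !linear0 !sqnorm0 !maxxx.
rewrite /round_to_box boxnormZ sqr_sqrtr ?divr_ge0 ?sqnorm_ge0 ?boxnorm_ge0 //.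
by rewrite divfK // gt_eqF // boxnorm_gt0.
Qed.

Lemma round_to_box_eq0 u : round_to_box u = 0 -> u = 0.
Proof.
move=> u0; apply: sqnorm_eq0; rewrite -boxnorm_round_to_box u0.
by rewrite /boxnorm !linear0 !sqnorm0 !maxxx.
Qed.

Lemma round_to_box_inj : injective round_to_box.
Proof.
move=> u v e; have : sqnorm u = sqnorm v by rewrite -!boxnorm_round_to_box e.
have [u0|u0] := eqVneq u 0.
  move=> _; rewrite u0; apply/esym/round_to_box_eq0.
  by rewrite -e u0 /round_to_box scaler0.
have [v0 _|v0] := eqVneq v 0.
  rewrite v0; apply/round_to_box_eq0.
  by rewrite e v0 /round_to_box scaler0.
move: e; rewrite /round_to_box; set k := Num.sqrt _; set l := Num.sqrt _.
have k0 : 0 < k by rewrite sqrtr_gt0 divr_gt0 ?sqnorm_gt0 ?boxnorm_gt0.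
have l0 : 0 < l by rewrite sqrtr_gt0 divr_gt0 ?sqnorm_gt0 ?boxnorm_gt0.
move=> kl; have -> : u = (k^-1 * l) *: v.
  by rewrite -scalerA -kl scalerA mulVf ?scale1r // gt_eqF.
rewrite sqnormZ => /eqP; rewrite -subr_eq0 -{2}[sqnorm v]mul1r -mulrBl.
rewrite mulf_eq0 subr_eq0 [sqnorm v == 0]gt_eqF ?sqnorm_gt0 // orbF.
have kl0 : 0 <= k^-1 * l by rewrite mulr_ge0 ?invr_ge0 ?ltW.
by rewrite pexpr_eq1 // => /eqP ->; rewrite scale1r.
Qed.

Lemma round_to_box_surj w : exists u, round_to_box u = w.
Proof.
have [->|w0] := eqVneq w 0.
  by exists 0; rewrite /round_to_box scaler0.
have s0 := sqnorm_gt0 w0; have b0 := boxnorm_gt0 w0.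
exists (Num.sqrt (boxnorm w / sqnorm w) *: w).
rewrite /round_to_box sqnormZ boxnormZ scalerA.
have c0 : 0 < boxnorm w / sqnorm w by rewrite divr_gt0.
rewrite sqr_sqrtr ?ltW //.
rewrite -mulf_div divff ?gt_eqF // mul1r -sqrtrM; last by rewrite divr_ge0 ?ltW.
rewrite mulf_div [sqnorm w * _]mulrC divff ?sqrtr1 ?scale1r //.
by rewrite mulf_neq0 // gt_eqF.
Qed.

(** Away from 0 this is clear; at 0 the bound [sqnorm_le_boxnorm] makes the
   coordinates of [round_to_box v] tend to 0 with [sqnorm v]. *)
Lemma round_to_box_continuous : continuous round_to_box.
Proof.
apply: mx_continuous => i j; rewrite ord1.
rewrite (_ : (fun u => _) =
    (fun u : V => Num.sqrt (sqnorm u / boxnorm u) * u 0 j)); last first.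
  by apply: funext => u; rewrite mxE.
move=> u.
have [->|u0] := eqVneq u 0; last first.
  apply: mulr_continuous_at; last exact: coord_continuous.
  have q : (fun v => sqnorm v / boxnorm v) @ u --> sqnorm u / boxnorm u.
    apply: divr_continuous_at; first by rewrite gt_eqF ?boxnorm_gt0.
      exact: sqnorm_continuous.
    exact: boxnorm_continuous.
  exact: (cvg_comp _ _ q (@sqrt_continuous R _)).
rewrite /continuous_at mxE mulr0.
have lim : (fun v : V => Num.sqrt (3 * sqnorm v)) @ (0 : V) --> (0 : R).
  have -> : 0 = Num.sqrt (3 * sqnorm (0 : V)) by rewrite sqnorm0 mulr0 sqrtr0.
  have q : (fun v : V => 3 * sqnorm v) @ (0 : V) --> 3 * sqnorm (0 : V).
    apply: (@mulr_continuous_at V (cst 3)); first exact: cst_continuous.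
    exact: sqnorm_continuous.
  exact: (cvg_comp _ _ q (@sqrt_continuous R _)).
apply: cvg0_normr_le lim => v.
rewrite -(@ler_pXn2r _ 2) ?nnegrE ?sqrtr_ge0 //.
rewrite real_normK ?num_real // sqr_sqrtr; last by rewrite mulr_ge0 ?sqnorm_ge0.
have := sqr_coord_le (round_to_box v) j; rewrite {1}/round_to_box mxE => /le_trans.
apply; apply: le_trans (sqnorm_le_boxnorm _) _.
by rewrite boxnorm_round_to_box.
Qed.

(** The affine identification of the middle coordinate with [[0, 1]]. *)
Definition box_split (w : V) : 'rV[R]_m * R * 'rV[R]_n :=
  (lsubmx w, (rsubmx w 0 (lshift n 0) + 1) / 2, rsubmx (rsubmx w)).

Definition disc_split (u : V) := box_split (round_to_box u).

Lemma disc_split_continuous : continuous disc_split.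
Proof.
apply: (comp_continuous round_to_box_continuous).
apply: pair_continuous; first apply: pair_continuous.
- exact: lsubmx_continuous.
- have ac : continuous (fun r : R => (r + 1) / 2).
    move=> r; apply: cvgM; last exact: cvg_cst.
    by apply: cvgD; [exact: cvg_id | exact: cvg_cst].
  have cc : continuous (fun w : V => rsubmx w 0 (lshift n 0)).
    exact: (comp_continuous (@rsubmx_continuous m (1 + n))
      (@coord_continuous R 1 (1 + n) 0 (lshift n 0))).
  exact: comp_continuous cc ac.
- exact: (comp_continuous (@rsubmx_continuous m (1 + n))
    (@rsubmx_continuous 1 n)).
Qed.

Lemma box_split_inj : injective box_split.
Proof.
move=> v w; rewrite /box_split => -[e1 e2 e3].
have e2' : rsubmx v 0 (lshift n 0) = rsubmx w 0 (lshift n 0).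
  by move/(mulIf _): e2 => /(_ _)/addIr; apply; rewrite invr_eq0 pnatr_eq0.
rewrite -(hsubmxK v) -(hsubmxK w) e1.
rewrite -(hsubmxK (rsubmx v)) -(hsubmxK (rsubmx w)) e3; congr (row_mx _ (row_mx _ _)).
by apply/rowP => i; rewrite ord1 !mxE; move: e2'; rewrite !mxE.
Qed.

Lemma box_split_surj p : exists w, box_split w = p.
Proof.
case: p => [[x t] y]; exists (row_mx x (row_mx (const_mx (2 * t - 1)) y)).
rewrite /box_split !row_mxKl !row_mxKr; congr (_, _, _).
by rewrite row_mxEl mxE subrK mulrC mulKf // pnatr_eq0.
Qed.

Lemma boxnorm_split w : boxnorm w = Num.max (Num.max (sqnorm (box_split w).1.1)
  ((2 * (box_split w).1.2 - 1) ^+ 2)) (sqnorm (box_split w).2).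
Proof.
rewrite /boxnorm /=; congr (Num.max (Num.max _ _) _).
by rewrite mulrC divfK ?pnatr_eq0 // addrK /sqnorm big_ord1 mxE.
Qed.

Lemma disc_split_inj : injective disc_split.
Proof. by move=> u v /box_split_inj/round_to_box_inj. Qed.

Lemma disc_split_surj p : exists u, disc_split u = p.
Proof.
have [w <-] := box_split_surj p; have [u <-] := round_to_box_surj w.
by exists u.
Qed.

Let sqr_mid (t : R) : ((2 * t - 1) ^+ 2 <= 1) = (0 <= t <= 1).
Proof.
rewrite -ler_sqrt // sqrtr_sqr sqrtr1 ler_norml; apply/andP/andP => -[]; split; lra.
Qed.

Let sqr_mid_lt (t : R) : ((2 * t - 1) ^+ 2 < 1) = (0 < t < 1).
Proof.
rewrite -ltr_sqrt // sqrtr_sqr sqrtr1 ltr_norml; apply/andP/andP => -[]; split; lra.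
Qed.

Lemma disc_splitE u : disc u <-> [/\ disc (disc_split u).1.1,
  0 <= (disc_split u).1.2 <= 1 & disc (disc_split u).2].
Proof.
rewrite /disc /= -!/(sqnorm _) -[in X in X <-> _]boxnorm_round_to_box boxnorm_split.
rewrite !ge_max sqr_mid; split=> [/andP[/andP[]]|[-> -> ->]] //.
Qed.

Lemma open_disc_splitE u : open_disc u <-> [/\ open_disc (disc_split u).1.1,
  0 < (disc_split u).1.2 < 1 & open_disc (disc_split u).2].
Proof.
rewrite /open_disc /= -!/(sqnorm _) -[in X in X <-> _]boxnorm_round_to_box.
rewrite boxnorm_split.
rewrite !gt_max sqr_mid_lt; split=> [/andP[/andP[]]|[-> -> ->]] //.
Qed.

Lemma sphere_splitE u : sphere u <-> disc u /\
  [\/ sphere (disc_split u).1.1, (disc_split u).1.2 = 0,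
    (disc_split u).1.2 = 1 | sphere (disc_split u).2].
Proof.
have hs k (x : 'rV[R]_k) : sphere x <-> disc x /\ ~ open_disc x.
  split=> [xS|[/discE[//|xO] nO]]; last by case: nO.
  by split; [exact: sphere_disc | exact: sphere_open_disc].
rewrite !hs open_disc_splitE; split=> [[uD nO]|[uD H]]; split=> //.
  have [xD /andP[t0 t1] yD] := (disc_splitE u).1 uD.
  have [xO|nx] := pselect (open_disc (disc_split u).1.1); last by apply: Or41; apply/hs.
  have [yO|ny] := pselect (open_disc (disc_split u).2); last by apply: Or44; apply/hs.
  move: t0; rewrite le_eqVlt => /orP[/eqP <-|t0]; first by apply: Or42.
  move: t1; rewrite le_eqVlt => /orP[/eqP ->|t1]; first by apply: Or43.
  by case: nO; split=> //; rewrite t0.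
case: H => [/sphere_open_disc nx []|-> [_]|-> [_]|/sphere_open_disc ny [_ _]] //.
  by rewrite ltxx.
by rewrite ltxx andbF.
Qed.

End CellProduct.

(** * The cell structure of a join *)

Section JoinCells.
Context {R : realType} {G : groupType}.
Context {X : topologicalType} {actX : G -> X -> X} {I : Type} {dX : I -> nat}
  {HX : I -> groupClosed G} {QX : forall i, 'rV[R]_(dX i) -> X}.
Context {Y : topologicalType} {actY : G -> Y -> Y} {J : Type} {dY : J -> nat}
  {HY : J -> groupClosed G} {QY : forall j, 'rV[R]_(dY j) -> Y}.
Arguments QX : clear implicits.
Arguments QY : clear implicits.
Hypothesis gcX : gcells actX HX QX.
Hypothesis gcY : gcells actY HY QY.

Let hX := gc_hausdorff gcX.
Let hY := gc_hausdorff gcY.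
Let act := join_act (R := R) actX actY.

Lemma join_act_jpt g p :
  act g (jpt p) = jpt (actX g p.1.1, p.1.2, actY g p.2).
Proof.
case: p => [[x t] y]; rewrite /jpt /=; case: insubP => [u _ _ //|_].
by case: eqP.
Qed.

Lemma join_is_action : is_action act.
Proof.
have [x1 xM xc] := gc_action gcX; have [y1 yM yc] := gc_action gcY.
split=> [[x|x t y|y]|g h [x|x t y|y]|g] /=; rewrite ?x1 ?y1 ?xM ?yM //.
apply/continuous_closedP => C /(closed_joinP _ hX hY)[cX cY cK].
apply/(closed_joinP _ hX hY); split.
- exact: (preimage_closed (fun x _ => xc g x) cX).
- exact: (preimage_closed (fun y _ => yc g y) cY).
- move=> K cptK Kslab.
  pose f (p : X * R * Y) := (actX g p.1.1, p.1.2, actY g p.2).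
  have fc : continuous f.
    apply: pair_continuous; last exact: (comp_continuous snd_continuous (yc g)).
    apply: pair_continuous.
      exact: (comp_continuous (comp_continuous fst_continuous fst_continuous) (xc g)).
    exact: (comp_continuous fst_continuous snd_continuous).
  rewrite (_ : _ `&` _ = K `&` f @^-1` (f @` K `&` jpt @^-1` C)).
    apply: closedI.
      apply: compact_closed cptK; apply: hausdorff_prod hY.
      by apply: hausdorff_prod hX _; exact: Rhausdorff.
    apply: (preimage_closed (fun p _ => fc p)); apply: cK.
      exact: (continuous_compact (continuous_subspaceT fc) cptK).
    by move=> _ [p /Kslab ? <-].
  apply/seteqP; split=> p [Kp Cp]; split=> //.
    split; first by exists p.
    by move: Cp; rewrite /preimage /= join_act_jpt.
  by case: Cp => _; rewrite /preimage /= join_act_jpt.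
Qed.

(** Cells of dimension [dX i + 1 + dY j] of the join correspond to the orbits
   of pairs of cells of types [i] and [j], hence to the double cosets of
   [HX i] and [HY j]. *)
Definition dcoset i j (g : G) : set G :=
  [set c | exists h k, [/\ h \in HX i, k \in HY j & c = (h * g * k)%g]].

Definition drepr i j g : G := xget 1%g (dcoset i j g).

Lemma drepr_dcoset i j g : dcoset i j g (drepr i j g).
Proof.
apply: xgetPex; exists g, 1%g, 1%g.
by split; [exact: gpred1 | exact: gpred1 | rewrite mul1g mulg1].
Qed.

Lemma drepr_eq i j g c : dcoset i j g c -> drepr i j c = drepr i j g.
Proof.
move=> [h [k [hH kH ->]]]; rewrite /drepr; congr xget; apply/seteqP; split=> x.
  move=> [h' [k' [h'H k'H ->]]]; exists (h' * h)%g, (k * k')%g.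
  by split; [exact: gpredM | exact: gpredM | rewrite !mulgA].
move=> [h' [k' [h'H k'H ->]]]; exists (h' * h^-1)%g, (k^-1 * k')%g.
split; [apply: gpredM => //; exact: gpredVr |
  apply: gpredM => //; exact: gpredVr |].
by rewrite !mulgA mulgVK mulgK.
Qed.

Definition mid_index := {p : I * J * G | drepr p.1.1 p.1.2 p.2 = p.2}.

Definition join_index := ((I + J) + mid_index)%type.

Definition join_dim (c : join_index) : nat :=
  match c with
  | inl (inl i) => dX i
  | inl (inr j) => dY j
  | inr m => dX (sval m).1.1 + (1 + dY (sval m).1.2)
  end.

Definition join_stab (c : join_index) : groupClosed G :=
  match c with
  | inl (inl i) => HX i
  | inl (inr j) => HY j
  | inr m => capg (HX (sval m).1.1) (conjsg (sval m).2 (HY (sval m).1.2))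
  end.

(** The map [D^(dX i + 1 + dY j) -> X × [0, 1] × Y] whose image is the product
   of two closed cells with [[0, 1]]. *)
Definition cell_prod g i g' j (v : 'rV[R]_(dX i + (1 + dY j))) : X * R * Y :=
  (actX g (QX i (disc_split v).1.1), (disc_split v).1.2,
   actY g' (QY j (disc_split v).2)).

Definition join_cell (c : join_index) : 'rV[R]_(join_dim c) -> join R X Y :=
  match c return 'rV[R]_(join_dim c) -> join R X Y with
  | inl (inl i) => fun x => join_inl R Y (QX i x)
  | inl (inr j) => fun y => join_inr R X (QY j y)
  | inr m => fun v => jpt (cell_prod 1%g (sval m).2 v)
  end.

Arguments join_cell : clear implicits.
Arguments cell_prod g {i} g' {j} v.

Lemma act_mid_cell g (m : mid_index) v : act g (join_cell (inr m) v) =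
  jpt (cell_prod g (g * (sval m).2)%g v).
Proof.
have [x1 _ _] := gc_action gcX; have [_ yM _] := gc_action gcY.
by rewrite /= join_act_jpt /cell_prod /= x1 yM.
Qed.

Lemma cell_prod_continuous g i g' j :
  {within @disc R (dX i + (1 + dY j)), continuous (@cell_prod g i g' j)}.
Proof.
have sc : {within @disc R (dX i + (1 + dY j)), continuous (@disc_split R _ _)}.
  exact/continuous_subspaceT/disc_split_continuous.
apply: within_continuous_pair; first apply: within_continuous_pair.
- apply: (within_continuous_comp (B := @disc R (dX i))
    (f := fun v => (disc_split v).1.1) (g := fun x => actX g (QX i x))).
  + exact: (continuous_comp_within sc
      (comp_continuous fst_continuous fst_continuous)).
  + by move=> v /disc_splitE[].
  + exact: (cell_within_continuous gcX).
- exact: (continuous_comp_within sc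
    (comp_continuous fst_continuous snd_continuous)).
- apply: (within_continuous_comp (B := @disc R (dY j))
    (f := fun v => (disc_split v).2) (g := fun x => actY g' (QY j x))).
  + exact: (continuous_comp_within sc snd_continuous).
  + by move=> v /disc_splitE[].
  + exact: (cell_within_continuous gcY).
Qed.

Lemma cell_prod_slab g i g' j v : disc v -> slab (@cell_prod g i g' j v).
Proof. by move=> /disc_splitE[]. Qed.

(** Writing the representative [c] as [h * (g^-1 * g') * k], one can absorb [h]
   and [k], which fix the two cells pointwise. *)
Lemma mid_translate g i g' j : exists h c, drepr i j c = c /\
  forall v : 'rV[R]_(dX i + (1 + dY j)), disc v ->
    cell_prod g g' v = cell_prod h (h * c)%g v.
Proof.
set c := drepr i j (g^-1 * g')%g.
have cc := drepr_dcoset i j (g^-1 * g')%g.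
have [h [k [hH kH ec]]] := cc.
exists (g * h^-1)%g, c; split; first by rewrite {1}/c (drepr_eq cc).
move=> v /disc_splitE[xD _ yD]; rewrite /cell_prod; congr (_, _, _).
  rewrite (act_cellM gcX); congr (actX g _).
  by rewrite (gc_fixed gcX xD) //; exact: gpredVr.
have -> : (g * h^-1 * c = g' * k)%g.
  by rewrite /c ec !mulgA mulgVK mulgV mul1g.
by rewrite (act_cellM gcY) (gc_fixed gcY yD kH).
Qed.

(** The translates of the chosen cells cover all products of two closed cells, so
   the trace of [C] on such a product is the image of a compact subset of a disc. *)
Lemma cell_prod_compact (C : set (join R X Y)) g i g' j :
  (forall h c (e : drepr i j c = c), closed [set v | disc v /\
    C (act h (join_cell (inr (exist _ (i, j, c) e)) v))]) ->
  compact [set p | [/\ closed_cell actX QX g i p.1.1, slab p,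
    closed_cell actY QY g' j p.2 & C (jpt p)]].
Proof.
have [h [c [e cpE]]] := mid_translate g i g' j; move=> /(_ h c e) cC.
pose D := [set v | disc v /\
  C (act h (join_cell (inr (exist _ (i, j, c) e)) v))].
rewrite (_ : mkset _ = @cell_prod g i g' j @` D).
  apply: (within_compact_image (@cell_prod_continuous g i g' j)) => [v []//|].
  apply: subclosed_compact cC (@compact_disc R _) _.
  by move=> v [].
apply/seteqP; split=> [[[x t] y]|_ [v [vD Cv] <-]].
  move=> [/= [x' x'D <-] tI [y' y'D <-] Cp].
  have [v vE] := disc_split_surj (x', t, y').
  have vD : disc v by apply/disc_splitE; rewrite vE.
  have vp : cell_prod g g' v = (actX g (QX i x'), t, actY g' (QY j y')).
    by rewrite /cell_prod vE.
  exists v => //; split=> //; rewrite act_mid_cell /= -cpE // vp.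
  exact: Cp.
have [xD _ yD] := (disc_splitE _).1 vD; split.
- by exists (disc_split v).1.1.
- exact: cell_prod_slab.
- by exists (disc_split v).2.
- by move: Cv; rewrite act_mid_cell /= -cpE.
Qed.

(** For a point in the boundary of a product of two cells, either coordinate may
   lie on the boundary of its cell or not; both possibilities are treated here at
   once. *)
Lemma gcells_disc_cell (E : topologicalType) (aE : G -> E -> E) (K : Type)
    (d : K -> nat) (H : K -> groupClosed G) (Q : forall k, 'rV[R]_(d k) -> E) :
  gcells aE H Q -> forall g k x, disc x -> exists h l z,
  [/\ (d l <= d k)%N, open_disc z, aE g (Q k x) = aE h (Q l z) &
      sphere x -> (d l < d k)%N].
Proof.
move=> gcE g k x /discE[xS|xO]; last first.
  by exists g, k, x; split=> // /sphere_open_disc.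
have [h [l [z [dl zO ->]]]] := gc_bdry gcE xS.
by exists (g * h)%g, l, z; split=> //; [exact: ltnW | rewrite (act_cellM gcE)].
Qed.

Lemma join_cover_mid g i x t g' j y : open_disc x -> 0 < t < 1 -> open_disc y ->
  exists h c (e : drepr i j c = c) v, open_disc v /\
    jpt (actX g (QX i x), t, actY g' (QY j y)) =
      act h (join_cell (inr (exist _ (i, j, c) e)) v).
Proof.
move=> xO tI yO; have [h [c [e cpE]]] := mid_translate g i g' j.
have [v vE] := disc_split_surj (x, t, y).
have vO : open_disc v by apply/open_disc_splitE; rewrite vE.
exists h, c, e, v; split=> //.
rewrite act_mid_cell /= -cpE; last exact: open_disc_disc.
by rewrite /cell_prod vE.
Qed.

(** The coordinates in [X] and in [Y] determine [i], [j] and the points of the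
   discs, and show that [g^-1 * g'] carries one double coset representative to the
   other, so that these coincide. *)
Lemma mid_cell_inj g g' (m m' : mid_index) v v' :
  open_disc v -> open_disc v' ->
  act g (join_cell (inr m) v) = act g' (join_cell (inr m') v') ->
  existT (fun c => 'rV[R]_(join_dim c)) (inr m) v = existT _ (inr m') v' /\
  (g^-1 * g')%g \in join_stab (inr m).
Proof.
move: m m' v v' => [[[i j] c] e] [[[i' j'] c'] e'] v v' vO v'O.
rewrite !act_mid_cell /=.
have [xO tI yO] := (open_disc_splitE _).1 vO.
have [x'O t'I y'O] := (open_disc_splitE _).1 v'O.
rewrite /cell_prod !(jpt_midE _ _ tI, jpt_midE _ _ t'I) => -[ex et ey].
have [eX gX] := gc_inj gcX xO x'O ex.
have [eY gY] := gc_inj gcY yO y'O ey.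
have ei : i = i' by case: eX.
have ej : j = j' by case: eY.
subst i' j'.
have kH : (c^-1 * (g^-1 * g') * c')%g \in HY j.
  by move: gY; rewrite invgM !mulgA.
have ec : c = c'.
  rewrite -[LHS]e -[RHS]e'; apply/esym/drepr_eq.
  exists (g^-1 * g')^-1%g, (c^-1 * (g^-1 * g') * c')%g; split=> //.
    exact: gpredVr.
  by rewrite -!mulgA mulVKg invgM invgK -!mulgA mulVKg mulKg.
subst c'; have ee : e = e' by exact: Prop_irrelevance.
subst e'; split; last first.
  by rewrite /= mem_capg gX mem_conjsg conjgE mulgA.
congr existT; apply: disc_split_inj.
have triple_eq (A B D : Type) (p q : A * B * D) :
    p.1.1 = q.1.1 -> p.1.2 = q.1.2 -> p.2 = q.2 -> p = q.
  by move: p q => [[? ?] ?] [[? ?] ?] /= -> -> ->.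
exact: triple_eq (existT_inj eX) et (existT_inj eY).
Qed.

(** The boundary of [D^p × [0, 1] × D^q] has the four faces of [sphere_splitE].
   Two of them are sent into closed cells of [X] and of [Y], the other two
   into finitely many products of closed cells. *)
Lemma mid_boundary_closed (C : set (join R X Y)) (m : mid_index) :
  (forall g c, (join_dim c < join_dim (inr m))%N ->
    closed [set x | disc x /\ C (act g (join_cell c x))]) ->
  closed [set v | sphere v /\ C (join_cell (inr m) v)].
Proof.
case: m => [[[i j] c] e]; rewrite /= => cC.
have hXRY : hausdorff_space (X * R * Y)%type.
  apply: hausdorff_prod hY; apply: hausdorff_prod hX _; exact: Rhausdorff.
have [_ yM _] := gc_action gcY.
pose W := 'rV[R]_(dX i + (1 + dY j)).
have c1 : continuous (fun v : W => (disc_split v).1.1).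
  exact: (comp_continuous (@disc_split_continuous R _ _)
    (comp_continuous fst_continuous fst_continuous)).
have c2 : continuous (fun v : W => (disc_split v).1.2).
  exact: (comp_continuous (@disc_split_continuous R _ _)
    (comp_continuous fst_continuous snd_continuous)).
have c3 : continuous (fun v : W => (disc_split v).2).
  exact: (comp_continuous (@disc_split_continuous R _ _) snd_continuous).
have [TX [finX bX TXP]] := boundary_finite_cells gcX 1%g i.
have [TY [finY bY TYP]] := boundary_finite_cells gcY c j.
pose M A B := [set p : X * R * Y | [/\ A p.1.1, slab p, B p.2 & C (jpt p)]].
have cM g k g' l : (dX k + (1 + dY l) < dX i + (1 + dY j))%N ->
    closed (M (closed_cell actX QX g k) (closed_cell actY QY g' l)).
  move=> dim; apply: compact_closed => //; apply: cell_prod_compact => h b eb.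
  exact: (cC h (inr (exist _ (k, l, b) eb))).
have cprod D : closed D -> closed [set v : W | disc v /\ D (cell_prod 1%g c v)].
  by apply: within_closed_preimage (@closed_disc R _) (@cell_prod_continuous _ _ _ _).
pose F1 := [set v : W | sphere (disc_split v).1.1] `&` [set v | disc v /\
  (\bigcup_(A in TX) M A (closed_cell actY QY c j)) (cell_prod 1%g c v)].
pose F2 := [set v : W | (disc_split v).1.2 = 0] `&` (disc (n := _) `&`
  (fun v => (disc_split v).1.1) @^-1` 
    [set x | disc x /\ C (act 1%g (join_inl R Y (QX i x)))]).
pose F3 := [set v : W | (disc_split v).1.2 = 1] `&` (disc (n := _) `&`
  (fun v => (disc_split v).2) @^-1` 
    [set y | disc y /\ C (act c (join_inr R X (QY j y)))]).
pose F4 := [set v : W | sphere (disc_split v).2] `&` [set v | disc v /\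
  (\bigcup_(B in TY) M (closed_cell actX QX 1%g i) B) (cell_prod 1%g c v)].
have [x1 _ _] := gc_action gcX.
have cell0 (v : W) : (disc_split v).1.2 = 0 ->
    jpt (cell_prod 1%g c v) = act 1%g (join_inl R Y (QX i (disc_split v).1.1)).
  by move=> v0; rewrite /cell_prod v0 jpt0.
have cell1 (v : W) : (disc_split v).1.2 = 1 ->
    jpt (cell_prod 1%g c v) = act c (join_inr R X (QY j (disc_split v).2)).
  by move=> v1; rewrite /cell_prod v1 jpt1.
rewrite (_ : mkset _ = F1 `|` F2 `|` F3 `|` F4).
  apply: closedU; first apply: closedU; first apply: closedU.
  - apply: closedI; first exact: (preimage_closed (fun v _ => c1 v) (@closed_sphere R _)).
    apply: cprod; apply: closed_bigcup => // A /TXP[g [k [-> dk]]].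
    by apply: cM; rewrite ltn_add2r.
  - apply: closedI; first exact: (preimage_closed (fun v _ => c2 v) (@closed_eq R 0)).
    apply: closedI; first exact: closed_disc.
    apply: (preimage_closed (fun v _ => c1 v)); apply: (cC 1%g (inl (inl i))).
    by rewrite /= addnCA add1n ltnS leq_addr.
  - apply: closedI; first exact: (preimage_closed (fun v _ => c2 v) (@closed_eq R 1)).
    apply: closedI; first exact: closed_disc.
    apply: (preimage_closed (fun v _ => c3 v)); apply: (cC c (inl (inr j))).
    by rewrite /= addnCA add1n ltnS leq_addl.
  - apply: closedI; first exact: (preimage_closed (fun v _ => c3 v) (@closed_sphere R _)).
    apply: cprod; apply: closed_bigcup => // B /TYP[g [l [-> dl]]].
    by apply: cM; rewrite ltn_add2l ltn_add2l.
apply/seteqP; split=> [v [/sphere_splitE[vD bd] Cv]|v].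
  have [xD tI yD] := (disc_splitE v).1 vD.
  case: bd => [xS|t0|t1|yS].
  - do 3 left; split=> //; split=> //.
    have [A TA Ax] := bX _ xS; exists A => //; split=> //.
    by exists (disc_split v).2.
  - do 2 left; right; split=> //; split=> //; split=> //.
    by rewrite -cell0.
  - left; right; split=> //; split=> //; split=> //.
    by rewrite -cell1.
  - right; split=> //; split=> //.
    have [B TB By] := bY _ yS; exists B => //; split=> //.
    by exists (disc_split v).1.1.
move=> [[[|]|]|].
- by move=> [xS [vD [A _ [_ _ _ Cv]]]]; split=> //;
    apply/sphere_splitE; split=> //; apply: Or41.
- move=> [t0 [vD [_ Cv]]]; split; last by rewrite cell0.
  by apply/sphere_splitE; split=> //; apply: Or42.
- move=> [t1 [vD [_ Cv]]]; split; last by rewrite cell1.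
  by apply/sphere_splitE; split=> //; apply: Or43.
- by move=> [yS [vD [B _ [_ _ _ Cv]]]]; split=> //;
    apply/sphere_splitE; split=> //; apply: Or44.
Qed.

(** The point is the weak topology: a compact subset of [X × [0, 1] × Y] lies over
   compact subsets of [X] and of [Y], hence in finitely many products of closed
   cells, and on these [cell_prod_compact] applies. *)
Lemma join_gcells : gcells act join_stab join_cell.
Proof.
have [x1 xM xc] := gc_action gcX; have [y1 yM yc] := gc_action gcY.
split.
- exact: join_is_action.
- exact: hausdorff_join.
- move=> [[i|j]|m] /=.
  + apply: (continuous_comp_within (gc_continuous gcX (i := i))).
    exact: join_inl_continuous.
  + apply: (continuous_comp_within (gc_continuous gcY (i := j))).
    exact: join_inr_continuous.
  + apply: (jpt_within_continuous hX hY (@hausdorff_rV R _) (@compact_disc R _)).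
      exact: cell_prod_continuous.
    exact: cell_prod_slab.
- move=> [[i|j]|m] x xD h hH.
  + by rewrite /= (gc_fixed gcX xD hH).
  + by rewrite /= (gc_fixed gcY xD hH).
  + have [x'D _ yD] := (disc_splitE _).1 xD.
    move: hH; rewrite /= mem_capg mem_conjsg => /andP[hHX hHY].
    rewrite act_mid_cell /= /cell_prod x1 (gc_fixed gcX x'D hHX).
    have -> : (h * (sval m).2 = (sval m).2 * h ^ (sval m).2)%g.
      by rewrite conjgE !mulgA mulgV mul1g.
    by rewrite yM (gc_fixed gcY yD hHY).
- move=> [x|x t y|y].
  + have [g [i [z [zO ->]]]] := gc_cover gcX x.
    by exists g, (inl (inl i)), z.
  + have [g [i [z [zO ->]]]] := gc_cover gcX x.
    have [g' [j [w [wO ->]]]] := gc_cover gcY y.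
    have [h [c [e [v [vO vE]]]]] := join_cover_mid g g' zO (valP t) wO.
    by exists h, (inr (exist _ (i, j, c) e)), v; rewrite -vE jpt_mid.
  + have [g [j [z [zO ->]]]] := gc_cover gcY y.
    by exists g, (inl (inr j)), z.
- move=> g g' [[i|j]|m] [[i'|j']|m'] x x' xO x'O.
  + move=> [/(gc_inj gcX xO x'O)[e gg']]; split=> //.
    have ei : i = i' by case: e.
    by subst i'; rewrite (existT_inj e).
  + by [].
  + rewrite act_mid_cell; have [_ tI _] := (open_disc_splitE _).1 x'O.
    by rewrite /cell_prod (jpt_midE _ _ tI).
  + by [].
  + move=> [/(gc_inj gcY xO x'O)[e gg']]; split=> //.
    have ei : j = j' by case: e.
    by subst j'; rewrite (existT_inj e).
  + rewrite act_mid_cell; have [_ tI _] := (open_disc_splitE _).1 x'O.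
    by rewrite /cell_prod (jpt_midE _ _ tI).
  + rewrite act_mid_cell; have [_ tI _] := (open_disc_splitE _).1 xO.
    by rewrite /cell_prod (jpt_midE _ _ tI).
  + rewrite act_mid_cell; have [_ tI _] := (open_disc_splitE _).1 xO.
    by rewrite /cell_prod (jpt_midE _ _ tI).
  + exact: mid_cell_inj.
- move=> [[i|j]|m] x xS.
  + have [g [i' [z [di zO ez]]]] := gc_bdry gcX xS.
    by exists g, (inl (inl i')), z; rewrite /= ez.
  + have [g [j' [z [dj zO ez]]]] := gc_bdry gcY xS.
    by exists g, (inl (inr j')), z; rewrite /= ez.
  + have [xD bd] := (sphere_splitE _).1 xS.
    have [x'D /andP[t0 t1] yD] := (disc_splitE _).1 xD.
    have [h [i' [z [di zO ez dis]]]] := gcells_disc_cell gcX 1%g x'D.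
    have [h' [j' [w [dj wO ew djs]]]] := gcells_disc_cell gcY (sval m).2 yD.
    rewrite /= /cell_prod ez ew.
    move: t0; rewrite le_eqVlt => /orP[/eqP <-|t0].
      exists h, (inl (inl i')), z; split=> //; last by rewrite jpt0.
      by rewrite /= addnCA add1n ltnS (leq_trans di) // leq_addr.
    move: t1; rewrite le_eqVlt => /orP[/eqP ->|t1].
      exists h', (inl (inr j')), w; split=> //; last by rewrite jpt1.
      by rewrite /= addnCA add1n ltnS (leq_trans dj) // leq_addl.
    have tI : 0 < (disc_split x).1.2 < 1 by rewrite t0.
    have [g [c [e [v [vO ->]]]]] := join_cover_mid h h' zO tI wO.
    exists g, (inr (exist _ (i', j', c) e)), v; split=> //=.
    rewrite !addnA !addn1 !addSn ltnS.
    case: bd => [/dis di'|t_0|t_1|/djs dj'].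
    * by rewrite -addSn leq_add.
    * by move: t0; rewrite t_0 ltxx.
    * by move: t1; rewrite t_1 ltxx.
    * by rewrite -addnS leq_add.
- move=> C cC; apply/(closed_joinP _ hX hY); split.
  + by apply: (gc_weak gcX) => g i; exact: (cC g (inl (inl i))).
  + by apply: (gc_weak gcY) => g j; exact: (cC g (inl (inr j))).
  + move=> K cK Kslab.
    have hXRY : hausdorff_space (X * R * Y)%type.
      apply: hausdorff_prod hY; apply: hausdorff_prod hX _; exact: Rhausdorff.
    have fstK : compact ((fun p : X * R * Y => p.1.1) @` K).
      apply: continuous_compact cK; apply: continuous_subspaceT.
      exact: (comp_continuous fst_continuous fst_continuous).
    have sndK : compact (snd @` K).
      apply: continuous_compact cK; apply: continuous_subspaceT.
      exact: snd_continuous.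
    have [TX [finX KX TXP]] := compact_finite_cells gcX fstK.
    have [TY [finY KY TYP]] := compact_finite_cells gcY sndK.
    rewrite (_ : _ `&` _ = K `&` \bigcup_(A in TX) \bigcup_(B in TY)
      [set p | [/\ A p.1.1, slab p, B p.2 & C (jpt p)]]).
      apply: closedI; first exact: compact_closed.
      apply: closed_bigcup => // A /TXP[g [i [-> _]]].
      apply: closed_bigcup => // B /TYP[g' [j [-> _]]].
      apply: compact_closed => //; apply: cell_prod_compact => h c e.
      exact: (cC h (inr (exist _ (i, j, c) e))).
    apply/seteqP; split=> p [Kp]; last by move=> [A _ [B _ []]].
    move=> Cp; split=> //.
    have [A TA Ap] : (\bigcup_(A in TX) A) p.1.1 by apply: KX; exists p.
    have [B TB Bp] : (\bigcup_(B in TY) B) p.2 by apply: KY; exists p.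
    by exists A => //; exists B => //; split=> //; exact: Kslab.
- move=> C [[i|j]|m] /= cC.
  + apply: (gc_bdry_weak gcX (C := @join_inl R X Y @^-1` C)) => g i' di.
    exact: (cC g (inl (inl i'))).
  + apply: (gc_bdry_weak gcY (C := @join_inr R X Y @^-1` C)) => g j' dj.
    exact: (cC g (inl (inr j'))).
  + exact: mid_boundary_closed.
Qed.

End JoinCells.

(** * Contractions *)

Section Contractions.
Context {R : realType}.
Local Notation I01 := (`[0, 1]%classic : set R).

Lemma closed_ext (T : topologicalType) (A B : set T) :
  closed A -> (forall x, A x <-> B x) -> closed B.
Proof. by move=> cA AB; have <- : A = B by apply/seteqP; split=> x /AB. Qed.

Lemma closed_I01 : closed I01.
Proof. exact: interval_closed. Qed.

Lemma compact_I01 : compact I01.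
Proof. exact: segment_compact. Qed.

Lemma I01E t : I01 t <-> 0 <= t <= 1.
Proof. by rewrite /= in_itv. Qed.

(** Although [E * R] carries the product topology, continuity can be checked on
   cells.  To separate [(z0, s0)] from the points sent into a closed set [D], use
   the set of the [z] for which [D] is hit at some time close to [s0]: it is closed,
   because its trace on each cell is the projection of a compact set. *)
Lemma homotopy_continuous (G : groupType) (E W : topologicalType)
    (act : G -> E -> E) (I : Type) (d : I -> nat) (H : I -> groupClosed G)
    (Q : forall i, 'rV[R]_(d i) -> E) (A : set E) (f : E * R -> W) :
  gcells act H Q ->
  (forall D g i, closed D -> closed [set p : 'rV[R]_(d i) * R |
    (@disc R (d i) `*` I01) p /\ (A (act g (Q i p.1)) /\ D (f (act g (Q i p.1), p.2)))]) ->
  {within A `*` I01, continuous f}.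
Proof.
move=> gcE cf; apply: closed_within_continuous => D cD.
rewrite -openC openE => -[z0 s0] nS.
have [s0I|s0I] := pselect (I01 s0); last first.
  exists (setT, ~` I01).
    by split; [exact: filterT | apply: open_nbhs_nbhs; split=> //;
      rewrite openC; exact: closed_I01].
  by move=> [z s] [_ /= nI] [[]].
have [g [i [x0 [xO ez]]]] := gc_cover gcE z0.
(* The times at which [D] is hit from [z0]; [s0] is not one of them. *)
pose T := [set s | I01 s /\ (A z0 /\ D (f (z0, s)))].
have cT : closed T.
  have sc : continuous (fun s : R => (x0, s)).
    by apply: pair_continuous; [exact: cst_continuous | move=> s; exact: cvg_id].
  have := preimage_closed (fun s _ => sc s) (cf D g i cD).
  congr closed; apply/seteqP; split=> s; rewrite /= -ez.
    by move=> [[_ sI]].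
  by move=> [sI AD]; split=> //; split=> //=; exact: open_disc_disc.
have nT : nbhs s0 (~` T).
  apply: open_nbhs_nbhs; split; first by rewrite openC.
  by move=> [_ AD]; apply: nS; split; [split | ]; case: AD.
have /nbhs_ballP[e /= e0 eT] := nT.
pose J := [set s : R | `|s - s0| <= e / 2].
have cJ : closed J.
  apply: (@preimage_closed _ _ (fun s : R => `|s - s0|) [set r | r <= e / 2]).
    move=> s _; apply: cvg_norm; apply: cvgB; [exact: cvg_id | exact: cvg_cst].
  exact: closed_le.
have JT s : J s -> ~ T s.
  move=> Js; apply: eT; rewrite /ball /= distrC; apply: le_lt_trans Js _.
  by rewrite ltr_pdivrMr // ltr_pMr // ltr1n.
pose B := [set z | exists s, J s /\ (I01 s /\ (A z /\ D (f (z, s))))].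
have cB : closed B.
  apply: (gc_weak gcE) => h k.
  rewrite (_ : mkset _ = fst @` ([set p : 'rV[R]_(d k) * R |
      (@disc R (d k) `*` I01) p /\ (A (act h (Q k p.1)) /\ D (f (act h (Q k p.1), p.2)))]
      `&` (snd @^-1` J))).
    apply: compact_closed; first exact: hausdorff_rV.
    apply: continuous_compact.
      exact/continuous_subspaceT/fst_continuous.
    apply: (@subclosed_compact _ _ (@disc R (d k) `*` I01)).
    - apply: closedI; first exact: cf.
      by apply: preimage_closed cJ => p _; exact: snd_continuous.
    - by apply: compact_setX; [exact: compact_disc | exact: compact_I01].
    - by move=> p [[]].
  apply/seteqP; split=> [x [xD [s [Js [sI AD]]]]|_ [[x s] [[[xD sI] AD] Js] <-]].
    by exists (x, s).
  by split=> //; exists s.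
exists (~` B, ball s0 (e / 2)).
  split=> /=; last by apply: nbhsx_ballx; rewrite divr_gt0.
  apply: open_nbhs_nbhs; split; first by rewrite openC.
  by move=> [s [Js Ts]]; apply: (JT s Js); case: Ts.
move=> [z s] [/= nB bs] [[Az sI] Ds]; apply: nB; exists s; split=> //.
by apply: ltW; rewrite distrC.
Qed.

(** The contraction is carried over by a left inverse [rho] of [i], continuous on
   [i @` A] because [i] is a closed map. *)
Lemma contractible_closed_embedding (E W : topologicalType) (i : E -> W)
    (A : set E) :
  continuous i -> injective i -> (forall C, closed C -> closed (i @` C)) ->
  contractible R A -> contractible R (i @` A).
Proof.
move=> ic ii icl [a Aa [h [hc hA h0 h1]]].
exists (i a); first by exists a.
pose rho w := xget a [set e | i e = w].
have rhoK e : rho (i e) = e.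
  by apply: ii; apply: (xgetPex a (P := [set e' | i e' = i e])); exists e.
exists (fun p => i (h (rho p.1, p.2))); split.
- have c1 : {within i @` A `*` I01, continuous (fun p : W * R => (rho p.1, p.2))}.
    apply: within_continuous_pair; last first.
      by apply: continuous_subspaceT; exact: snd_continuous.
    apply/continuous_closedP => C cC; apply/closed_subspaceP.
    exists (fst @^-1` (i @` C)).
      by apply: preimage_closed (icl _ cC) => p _; exact: fst_continuous.
    apply/seteqP; split=> -[w s] [/= Cw [[e Ae ew] sI]];
        (split; last by split=> //; exists e).
      by move: Cw => [c Cc ec]; change (C (rho w)); rewrite -ec rhoK.
    by change (C (rho w)) in Cw; exists e => //; rewrite -(rhoK e) ew.
  have c0 p : (i @` A `*` I01) p -> (A `*` I01) (rho p.1, p.2).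
    by case: p => w s [[e Ae <-] sI]; split=> //=; rewrite rhoK.
  exact: (continuous_comp_within (within_continuous_comp c1 c0 hc) ic).
- by move=> _ t [e Ae <-] tI; exists (h (e, t)); [exact: hA | rewrite /= rhoK].
- by move=> _ [e Ae <-] /=; rewrite rhoK h0.
- by move=> _ [e Ae <-] /=; rewrite rhoK h1.
Qed.

Lemma closed_eq_fun (T U : topologicalType) (f g : T -> U) :
  hausdorff_space U -> continuous f -> continuous g ->
  closed [set x | f x = g x].
Proof.
move=> hU fc gc x cl; apply: hU => A B fA gB.
have nAB : nbhs x (f @^-1` A `&` g @^-1` B).
  by apply: filterI; [exact: fc | exact: gc].
have [z [/= e [Az Bz]]] := cl _ nAB.
by exists (f z); split=> //; rewrite e.
Qed.

Lemma closed_fixed_set (G : groupType) (E : topologicalType)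
    (act : G -> E -> E) (L : groupClosed G) :
  is_action act -> hausdorff_space E -> closed (fixed_set act L).
Proof.
move=> [_ _ ac] hE; rewrite (_ : fixed_set act L =
  \bigcap_(h in [set` L]) [set x | act h x = x]); last by [].
apply: closed_bigI => h _; apply: closed_eq_fun => // x.
exact: cvg_id.
Qed.

(** In the first half of the time [X] is contracted to a point [a], then the
   resulting cone on [Y] is contracted to its apex.  The two halves are given by
   one formula, in which [early] and [late] are the clocks. *)
Definition early (s : R) := Num.min 1 (2 * s).
Definition late (s : R) := Num.min 1 (2 - 2 * s).

Lemma early_I01 s : I01 s -> I01 (early s).
Proof.
move=> /I01E/andP[s0 s1]; apply/I01E; rewrite /early ge_min lexx le_min ler01 /=.
by rewrite andbT mulr_ge0.
Qed.

Lemma late_I01 s : I01 s -> I01 (late s).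
Proof.
move=> /I01E/andP[s0 s1]; apply/I01E; rewrite /late ge_min lexx le_min ler01 /=.
by rewrite andbT; lra.
Qed.

Lemma minr_continuous (f : R -> R) :
  continuous f -> continuous (fun s => Num.min 1 (f s)).
Proof.
move=> fc s; apply: (@continuous_min _ _ (cst 1) f); last exact: fc.
exact: cst_continuous.
Qed.

Lemma early_continuous : continuous early.
Proof.
apply: minr_continuous => s; apply: cvgM; [exact: cvg_cst | exact: cvg_id].
Qed.

Lemma late_continuous : continuous late.
Proof.
apply: minr_continuous => s; apply: cvgB; first exact: cvg_cst.
by apply: cvgM; [exact: cvg_cst | exact: cvg_id].
Qed.

Lemma early_or_late s : early s = 1 \/ late s = 1.
Proof.
rewrite /early /late; have [le|] := boolP (2 * s <= 1).
  by right; apply/min_idPl; lra.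
by rewrite -ltNge => lt; left; apply/min_idPl; lra.
Qed.

Section Join.
Context {X Y : topologicalType} (AX : set X) (AY : set Y).

(** The join of the subspaces [AX] and [AY], inside the join of [X] and [Y]. *)
Definition subjoin : set (join R X Y) := fun p => match p with
  | join_inl x => AX x
  | join_mid x _ y => AX x /\ AY y
  | join_inr y => AY y
  end.

Lemma subjoin_jpt p : AX p.1.1 -> AY p.2 -> subjoin (jpt p).
Proof.
by move=> Ax Ay; rewrite /jpt; case: insub => [?|] //=; case: eqP.
Qed.

(** At the ends [t = 0] and [t = 1] of the slab, only one of the two coordinates is
   subject to a condition. *)
Lemma subjoin_jptP p : subjoin (jpt p) -> I01 p.1.2 ->
  [\/ p.1.2 = 0 /\ AX p.1.1, p.1.2 = 1 /\ AY p.2 | AX p.1.1 /\ AY p.2].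
Proof.
move=> Sp /I01E/andP[]; rewrite !le_eqVlt => /orP[/eqP/esym p0 _|p0].
  by apply: Or31; move: Sp; rewrite jpt_eq0.
move=> /orP[/eqP p1|p1]; first by apply: Or32; move: Sp; rewrite jpt_eq1.
have p01 : 0 < p.1.2 < 1 by rewrite p0.
move: p01 Sp; case: p {p0 p1} => [[x t] y] p01; rewrite (jpt_midE _ _ p01).
exact: Or33.
Qed.

Lemma fixed_set_join (G : groupType) (actX : G -> X -> X) (actY : G -> Y -> Y)
  (L : groupClosed G) : AX = fixed_set actX L -> AY = fixed_set actY L ->
  fixed_set (join_act (R := R) actX actY) L = subjoin.
Proof.
move=> eX eY; rewrite /subjoin eX eY; apply/seteqP; split=> -[x|x t y|y] /=.
- by move=> fx h /fx [].
- by move=> fx; split=> h /fx [].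
- by move=> fx h /fx [].
- by move=> fx h /fx /= ->.
- by move=> [fx fy] h hL /=; rewrite fx ?fy.
- by move=> fx h /fx /= ->.
Qed.

Hypotheses (hX : hausdorff_space X) (hY : hausdorff_space Y).
Hypotheses (clX : closed AX) (clY : closed AY).
Variables (a : X) (h : X * R -> X).
Hypotheses (Aa : AX a) (hc : {within AX `*` I01, continuous h})
  (hA : forall x t, AX x -> I01 t -> AX (h (x, t)))
  (h0 : forall x, AX x -> h (x, 0) = x) (h1 : forall x, AX x -> h (x, 1) = a).

Definition join_homotopy (ps : join R X Y * R) : join R X Y :=
  match ps.1 with
  | join_inl x => join_inl R Y (h (x, early ps.2))
  | join_mid x t y => jpt (h (x, early ps.2), val t * late ps.2, y)
  | join_inr y => jpt (a, late ps.2, y)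
  end.

(** The three formulas of [join_homotopy], on a compact space of parameters. *)
Section Formulas.
Variables (T : topologicalType) (P : set T) (xf : T -> X) (tf sf : T -> R)
  (yf : T -> Y) (D : set (join R X Y)).
Hypotheses (hT : hausdorff_space T) (cP : compact P) (cD : closed D).
Hypotheses (tI : forall p, P p -> I01 (tf p)) (sI : forall p, P p -> I01 (sf p)).
Hypotheses (tc : {within P, continuous tf}) (sc : {within P, continuous sf}).

Let h_continuous : {within P, continuous xf} ->
  {within [set p | P p /\ AX (xf p)],
    continuous (fun p => h (xf p, early (sf p)))}.
Proof.
move=> xc.
apply: (within_continuous_comp (f := fun p => (xf p, early (sf p))) _ _ hc).
  apply: within_continuous_pair.
    by apply: continuous_subspaceW xc => p [].
  apply: continuous_comp_within early_continuous.
  by apply: continuous_subspaceW sc => p [].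
by move=> p [Pp Ap]; split=> //=; apply: early_I01; exact: sI.
Qed.

Let closed_AX : {within P, continuous xf} -> closed [set p | P p /\ AX (xf p)].
Proof. by move=> xc; apply: within_closed_preimage => //; exact: compact_closed. Qed.

Let closed_AY : {within P, continuous yf} -> closed [set p | P p /\ AY (yf p)].
Proof. by move=> xc; apply: within_closed_preimage => //; exact: compact_closed. Qed.

Lemma closed_formula_inl : {within P, continuous xf} ->
  closed [set p | P p /\
    (AX (xf p) /\ D (join_inl R Y (h (xf p, early (sf p)))))].
Proof.
move=> xc; have := within_closed_preimage (closed_AX xc)
  (continuous_comp_within (h_continuous xc) (join_inl_continuous hX hY)) cD.
by congr closed; apply/seteqP; split=> p [] => [[]|? []].
Qed.

Lemma closed_formula_inr : {within P, continuous yf} ->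
  closed [set p | P p /\ (AY (yf p) /\ D (jpt (a, late (sf p), yf p)))].
Proof.
move=> yc; have fc : {within [set p | P p /\ AY (yf p)],
    continuous (@jpt R X Y \o (fun p => (a, late (sf p), yf p)))}.
  apply: (jpt_within_continuous hX hY hT).
  - by apply: subclosed_compact (closed_AY yc) cP _ => p [].
  - apply: within_continuous_pair; last by apply: continuous_subspaceW yc => p [].
    apply: within_continuous_pair.
      by apply: continuous_subspaceT; exact: cst_continuous.
    apply: continuous_comp_within late_continuous.
    by apply: continuous_subspaceW sc => p [].
  - by move=> p [Pp _]; apply/I01E; apply: late_I01; exact: sI.
have := within_closed_preimage (closed_AY yc) fc cD.
by congr closed; apply/seteqP; split=> p [] => [[]|? []].
Qed.

Lemma closed_formula_mid :
  {within P, continuous xf} -> {within P, continuous yf} ->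
  closed [set p | P p /\ ((AX (xf p) /\ AY (yf p)) /\
    D (jpt (h (xf p, early (sf p)), tf p * late (sf p), yf p)))].
Proof.
move=> xc yc; pose P' := [set p | P p /\ AX (xf p)] `&` [set p | P p /\ AY (yf p)].
have clP' : closed P' by apply: closedI; [exact: closed_AX | exact: closed_AY].
have P'P : P' `<=` P by move=> p [[]].
have fc : {within P', continuous (@jpt R X Y \o
    (fun p => (h (xf p, early (sf p)), tf p * late (sf p), yf p)))}.
  apply: (jpt_within_continuous hX hY hT).
  - exact: subclosed_compact clP' cP P'P.
  - apply: within_continuous_pair; last exact: continuous_subspaceW yc.
    apply: within_continuous_pair.
      by apply: continuous_subspaceW (h_continuous xc) => p [].
    have lc : {within P', continuous (late \o sf)}.
      apply: continuous_comp_within late_continuous.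
      exact: continuous_subspaceW sc.
    have tc' : {within P', continuous tf} by exact: continuous_subspaceW tc.
    by move=> p; apply: cvgM; [exact: tc' | exact: lc].
  - move=> p /P'P Pp; apply/andP => /=.
    have /I01E/andP[t0 t1] := tI Pp.
    have /I01E/andP[l0 l1] := late_I01 (sI Pp).
    by split; [exact: mulr_ge0 | exact: mulr_ile1].
have := within_closed_preimage clP' fc cD.
congr closed; apply/seteqP; split=> p.
  by move=> [[[Pp Ap] [_ Bp]] Dp].
by move=> [Pp [[Ap Bp] Dp]].
Qed.

End Formulas.

(** When [t = 1], the two sides agree because [late s = 1], unless [early s = 1],
   in which case [h] has reached the point [a]. *)
Lemma join_homotopy_jpt p s : I01 p.1.2 -> AX p.1.1 ->
  join_homotopy (jpt p, s) = jpt (h (p.1.1, early s), p.1.2 * late s, p.2).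
Proof.
move=> /I01E/andP[]; rewrite le_eqVlt => /orP[/eqP/esym p0 _ _|p0].
  by rewrite jpt_eq0 // p0 mul0r jpt0.
rewrite le_eqVlt => /orP[/eqP p1|p1] Ax; last first.
  have p01 : 0 < p.1.2 < 1 by rewrite p0.
  by move: p01; case: p {p0 p1 Ax} => [[x t] y] p01; rewrite (jpt_midE _ _ p01).
rewrite jpt_eq1 // p1 mul1r /join_homotopy /=.
by case: (early_or_late s) => ->; [rewrite h1 | rewrite !jpt1].
Qed.

End Join.

(** If [AX] is contractible, so is its join with any [AY], by [join_homotopy].
   Its continuity is checked on cells; on a mixed cell, the points of [subjoin]
   form three closed sets, by [subjoin_jptP], and each has its own formula. *)
Lemma contractible_subjoin (G : groupType)
    (X : topologicalType) (actX : G -> X -> X) (I : Type) (dX : I -> nat)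
    (HX : I -> groupClosed G) (QX : forall i, 'rV[R]_(dX i) -> X)
    (Y : topologicalType) (actY : G -> Y -> Y) (J : Type) (dY : J -> nat)
    (HY : J -> groupClosed G) (QY : forall j, 'rV[R]_(dY j) -> Y)
    (AX : set X) (AY : set Y) :
  gcells actX HX QX -> gcells actY HY QY -> closed AX -> closed AY ->
  contractible R AX -> contractible R (subjoin AX AY).
Proof.
move=> gcX gcY clX clY [a Aa [h [hc hA' h0 h1]]].
have hX := gc_hausdorff gcX; have hY := gc_hausdorff gcY.
have hA x t : AX x -> I01 t -> AX (h (x, t)) by move=> Ax tI; exact: hA'.
exists (join_inl R Y a) => //; exists (join_homotopy a h); split.
- apply: (homotopy_continuous (join_gcells gcX gcY)) => D g c cD.
  have hT n : hausdorff_space ('rV[R]_n * R)%type.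
    by apply: hausdorff_prod; [exact: hausdorff_rV | exact: Rhausdorff].
  have cP n : compact (@disc R n `*` I01).
    by apply: compact_setX; [exact: compact_disc | exact: compact_I01].
  have sc n : {within @disc R n `*` I01, continuous snd}.
    by apply: continuous_subspaceT; exact: snd_continuous.
  have fstc n : {within @disc R n `*` I01, continuous fst}.
    by apply: continuous_subspaceT; exact: fst_continuous.
  have sI n p : (@disc R n `*` I01) p -> I01 p.2 by case.
  have fstD n p : (@disc R n `*` I01) p -> disc p.1 by case.
  have xc i k : {within @disc R (dX i) `*` I01,
      continuous (fun p => actX k (QX i p.1))}.
    exact: (within_continuous_comp (fstc _) (@fstD _)
      (@cell_within_continuous _ _ _ _ _ _ _ _ gcX k i)).
  have yc j k : {within @disc R (dY j) `*` I01,
      continuous (fun p => actY k (QY j p.1))}.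
    exact: (within_continuous_comp (fstc _) (@fstD _)
      (@cell_within_continuous _ _ _ _ _ _ _ _ gcY k j)).
  case: c => [[i|j]|m] /=.
  + exact: (closed_formula_inl hX hY clX hc (hT _) (cP _) cD (@sI _) (sc _) (xc _ _)).
  + exact: (closed_formula_inr hX hY clY (a := a) (hT _) (cP _) cD (@sI _) (sc _) (yc _ _)).
  + set i := (sval m).1.1; set j := (sval m).1.2; set c := (g * (sval m).2)%g.
    pose cp (p : 'rV[R]_(dX i + (1 + dY j)) * R) :=
      @cell_prod R G X actX I dX QX Y actY J dY QY g i c j p.1.
    have mE (p : 'rV[R]_(dX i + (1 + dY j)) * R) :
        join_act actX actY g (jpt (@cell_prod R G X actX I dX QX Y actY J dY QY
          1%g i (sval m).2 j p.1)) = jpt (cp p).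
      exact: (act_mid_cell gcX gcY g (m := m) p.1).
    have cpc : {within @disc R (dX i + (1 + dY j)) `*` I01, continuous cp}.
      exact: (within_continuous_comp (fstc _) (@fstD _)
        (@cell_prod_continuous _ _ _ _ _ _ _ _ _ _ _ _ _ _ gcX gcY g i c j)).
    have cx := continuous_comp_within cpc
      (comp_continuous fst_continuous fst_continuous).
    have ct := continuous_comp_within cpc
      (comp_continuous fst_continuous snd_continuous).
    have cy := continuous_comp_within cpc snd_continuous.
    have tI p : (@disc R (dX i + (1 + dY j)) `*` I01) p -> I01 (cp p).1.2.
      by move=> [/disc_splitE[_ tI _] _]; apply/I01E.
    pose Fl := [set p : 'rV[R]_(dX i + (1 + dY j)) * R | 
      (@disc R _ `*` I01) p /\ (cp p).1.2 = 0].
    pose Fr := [set p : 'rV[R]_(dX i + (1 + dY j)) * R | 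
      (@disc R _ `*` I01) p /\ (cp p).1.2 = 1].
    have clP : closed (@disc R (dX i + (1 + dY j)) `*` I01).
      by apply: compact_closed (cP _); exact: hT.
    have clFl : closed Fl.
      exact: (within_closed_preimage clP ct (closed_eq (y := 0))).
    have clFr : closed Fr.
      exact: (within_closed_preimage clP ct (closed_eq (y := 1))).
    apply: (closed_ext (closedU (closedU
      (closedI clFl (closed_formula_inl hX hY clX hc (hT _) (cP _) cD (@sI _)
        (sc _) cx))
      (closedI clFr (closed_formula_inr hX hY clY (a := a) (hT _) (cP _) cD (@sI _)
        (sc _) cy)))
      (closed_formula_mid hX hY clX clY hc (hT _) (cP _) cD tI (@sI _) ct (sc _)
        cx cy))) => p; split.
      move=> [[[[pP t0] [_ [Ax Dp]]]|[[_ t1] [pP [Ay Dp]]]]|[pP [[Ax Ay] Dp]]].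
      * by split=> //; rewrite mE jpt_eq0.
      * by split=> //; rewrite mE jpt_eq1.
      * split=> //; rewrite mE; split; first exact: subjoin_jpt.
        by rewrite (join_homotopy_jpt h1) //; exact: tI.
    move=> [pP]; rewrite mE => -[Sp Dp].
    have [[t0 Ax]|[t1 Ay]|[Ax Ay]] := subjoin_jptP Sp (tI _ pP).
    * left; left; split; first by split.
      by split=> //; split=> //; move: Dp; rewrite jpt_eq0.
    * left; right; split; first by split.
      by split=> //; split=> //; move: Dp; rewrite jpt_eq1.
    * right; split=> //; split=> //.
      by move: Dp; rewrite (join_homotopy_jpt h1) //; exact: tI.
- move=> [x|x t y|y] s Ap sI.
  + exact: hA Ap (early_I01 sI).
  + by case: Ap => Ax Ay; apply: subjoin_jpt => //; exact: hA Ax (early_I01 sI).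
  + exact: subjoin_jpt.
- have e0 : early 0 = 0 by rewrite /early mulr0; apply/min_idPr.
  have l0 : late 0 = 1 by rewrite /late mulr0 subr0; apply/min_idPl; rewrite ler1n.
  move=> [x|x t y|y] Ap; rewrite /join_homotopy /= ?e0 ?l0.
  + by rewrite h0.
  + by case: Ap => Ax _; rewrite h0 // mulr1 jpt_mid.
  + by rewrite jpt1.
- have e0 : early 1 = 1 by rewrite /early mulr1; apply/min_idPl; rewrite ler1n.
  have l0 : late 1 = 0 by rewrite /late mulr1 subrr; apply/min_idPr.
  move=> [x|x t y|y] Ap; rewrite /join_homotopy /= ?e0 ?l0.
  + by rewrite h1.
  + by case: Ap => Ax _; rewrite mulr0 jpt0 h1.
  + by rewrite jpt0.
Qed.

End Contractions.

(** * Fixed points *)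

Section Conjugates.
Context {G : groupType}.
Implicit Types (L K : groupClosed G) (g h : G).

Lemma mem_conjsgV g L x : ((x ^ g)%g \in conjsg g^-1 L) = (x \in L).
Proof. by rewrite mem_conjsg conjgK. Qed.

Lemma sub_capg (K L M : groupClosed G) :
  {subset K <= L} -> {subset K <= M} -> {subset K <= capg L M}.
Proof. by move=> KL KM x xK; rewrite mem_capg KL ?KM. Qed.

Lemma conjsg_eq g h L : (g^-1 * h)%g \in L -> conjsg g L = conjsg h L.
Proof.
move=> ghL; apply: subgroup_ext => x; rewrite !mem_conjsg.
have -> : (x ^ h = (x ^ g) ^ (g^-1 * h))%g by rewrite -conjgM mulVKg.
have gpredJ (y z : G) : y \in L -> z \in L -> (y ^ z)%g \in L.
  by move=> yL zL; rewrite conjgE; apply: gpredM; [exact: gpredVr | exact: gpredM].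
apply/idP/idP => xL; first exact: gpredJ.
by rewrite -[(x ^ g)%g](conjgK (g^-1 * h)%g); apply: gpredJ => //; exact: gpredVr.
Qed.

Lemma normalizer_conjsg g h L : conjsg g L = conjsg h L ->
  normalizer L (g^-1 * h)%g.
Proof.
move=> e; apply: subgroup_ext => x; rewrite mem_conjsg.
have -> : (x ^ (g^-1 * h) = (x ^ g^-1) ^ h)%g by rewrite conjgM.
by rewrite -mem_conjsg -e mem_conjsg conjgKV.
Qed.

Context {L : groupClosed G}.

Definition preim_pred (M : groupClosed G) : {pred subgroup_type L} :=
  [pred x | val x \in M].

Fact preim_invr M : invg_closed (preim_pred M).
Proof. by move=> x; rewrite !inE => xM; rewrite /=; exact: gpredVr. Qed.

Fact preim_1 M : 1%g \in preim_pred M.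
Proof. by rewrite inE; exact: gpred1. Qed.

Fact preim_mul M : mulg_closed (preim_pred M).
Proof. by move=> x y; rewrite !inE => xM yM; rewrite /=; exact: gpredM. Qed.

Definition preim_sg (M : groupClosed G) : groupClosed (subgroup_type L) :=
  HB.pack_for (groupClosed (subgroup_type L)) (preim_pred M)
    (isInvClosed.Build (subgroup_type L) (preim_pred M) (@preim_invr M))
    (isMul1Closed.Build (subgroup_type L) (preim_pred M) (@preim_1 M))
    (isMulClosed.Build (subgroup_type L) (preim_pred M) (@preim_mul M)).

Lemma mem_preim_sg M x : (x \in preim_sg M) = (val x \in M).
Proof. by []. Qed.

End Conjugates.

Lemma lcoset_act_fixed (G : groupType) (L : groupClosed G) (g : G)
    (A : lcosets L) a :
  val A a -> lcoset_act g A = A <-> g \in conjsg a L.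
Proof.
move=> Aa; have gA : val (lcoset_act g A) (g * a)%g by rewrite mem_lcoset_act.
rewrite mem_conjsg conjgE; split=> [e|gL].
  by apply: lcosets_div Aa _; rewrite -[X in val X _]e.
by apply: lcosets_eq gA _; rewrite (lcosetsP Aa).
Qed.

(** An element [l] that preserves the coset of [a := r A] acts on the copy of [E]
   over this coset through the cocycle, whose value is then [a^-1 l a]. *)
Lemma fixed_set_induced (G : groupType) (L : groupClosed G) (E : topologicalType)
    (act : subgroup_type L -> E -> E) (r : coset_repr L) (M : groupClosed G)
    (A : lcosets L) (e : E) :
  fixed_set (induced_act act r) M (existT _ A e) <->
  {subset M <= conjsg (r A) L} /\
  fixed_set act (preim_sg (conjsg (r A)^-1%g M)) e.
Proof.
have Ar := coset_reprP r A.
have cocycleE l : lcoset_act l A = A ->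
    val (coset_cocycle r l A) = (l ^ r A)%g.
  by move=> lA; rewrite /= lA conjgE mulgA.
split=> [fx|[ML fe] l lM].
  have lA l : l \in M -> lcoset_act l A = A.
    by move=> /fx/(congr1 (fun p : induced_space L E => projT1 p)).
  split=> [l /lA/(lcoset_act_fixed _ Ar)//|k kM].
  have lM : (val k ^ (r A)^-1)%g \in M by rewrite -mem_conjsg.
  have := congr1 (fun p : induced_space L E => projT2 p) (fx _ lM).
  rewrite /= (_ : coset_cocycle _ _ _ = k) //; apply: val_inj.
  by rewrite cocycleE ?conjgKV //; exact: lA.
have lA : lcoset_act l A = A by apply/(lcoset_act_fixed _ Ar)/ML.
rewrite /induced_act /= lA fe // mem_preim_sg cocycleE //.
by rewrite mem_conjsgV.
Qed.

Lemma fixed_set_coprod (G : groupType) (J : choiceType)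
    (E : J -> topologicalType) (act : forall j, G -> E j -> E j)
    (M : groupClosed G) j (e : E j) :
  fixed_set (coprod_act act) M (existT _ j e) <-> fixed_set (act j) M e.
Proof.
split=> fe l lM; last by rewrite /coprod_act /= fe.
by have := existT_inj (fe l lM).
Qed.

(** If [a^-1 M a] is the intersection with [L] of a member [N] of [F], then [M] is
   contained in [a N a^-1], which belongs to [F]. *)
Lemma restrict_familyP (G : groupType) (L M : groupClosed G)
    (F : set (groupClosed G)) (a : G) :
  is_family F -> {subset M <= conjsg a L} ->
  restrict_family L F (preim_sg (conjsg a^-1%g M)) <-> F M.
Proof.
move=> [Fsub Fconj] ML; split=> [[N FN NE]|FM]; last first.
  by exists (conjsg a^-1%g M); [exact: Fconj | move=> x; rewrite mem_preim_sg].
apply: (Fsub (conjsg a N)); first exact: Fconj.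
move=> l lM; rewrite mem_conjsg; have laL : (l ^ a)%g \in L by exact: ML.
by rewrite -(NE (exist (fun x => x \in L) _ laL)) mem_preim_sg mem_conjsgV.
Qed.

Lemma closed_existT (J : choiceType) (E : J -> topologicalType) j
    (C : set (E j)) : closed C -> closed (existT E j @` C).
Proof.
move=> cC; apply/sigT_closedP => k; have [ejk|njk] := pselect (j = k).
  subst k; apply: (closed_ext cC) => e.
  split=> [Ce|[c Cc ee]]; first by exists e.
  by rewrite -(existT_inj ee).
apply: (closed_ext closed0) => e; split=> // -[c _ ee].
by apply: njk; case: ee.
Qed.

(** Two members of an adapted collection containing [M] coincide when [M] is not
   in [F]; as they are self-normalizing, the conjugating element then determines
   a single coset. *)
Lemma unique_fixed_coset (G : groupType) (F Ft : set (groupClosed G))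
    (I : Type) (H : I -> groupClosed G) (J : choiceType)
    (Lambda : J -> groupClosed G) (M : groupClosed G) j j' (a a' : G) :
  is_family F -> adapted F Ft (range H) -> range Lambda `<=` range H ->
  (forall i, exists! j, exists g, H i = conjsg g (Lambda j)) ->
  ~ F M ->
  {subset M <= conjsg a (Lambda j)} -> {subset M <= conjsg a' (Lambda j')} ->
  exists e : j = j', (a^-1 * a')%g \in Lambda j.
Proof.
move=> famF [capF conjH normH _] LambdaH LambdaP nFM Ma Ma'.
have LH k : range H (Lambda k) by apply: LambdaH; exists k.
have ec : conjsg a (Lambda j) = conjsg a' (Lambda j').
  have [//|Fcap] := capF _ _ (conjH a _ (LH j)) (conjH a' _ (LH j')).
  by case: nFM; apply: famF.1 Fcap _; exact: sub_capg.
have [i _ Hi] := conjH a _ (LH j).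
have [k [_ kuniq]] := LambdaP i.
have ek l b : H i = conjsg b (Lambda l) -> k = l.
  by move=> e; apply: kuniq; exists b.
have ej : j = j'.
  by transitivity k; [apply/esym/(ek j a) | apply: (ek j' a'); rewrite -ec].
exists ej; subst j'; have := normalizer_conjsg ec.
by rewrite normH.
Qed.

Theorem theorem2p3 (R : realType) (Gamma : groupType)
  (fgGamma : finitely_generated Gamma)
  (F Ft : set (groupClosed Gamma))
  (famF : is_family F) (famFt : is_family Ft) (subFFt : F `<=` Ft)
  (I : Type) (H : I -> groupClosed Gamma)
  (adaptedH : adapted F Ft (range H))
  (J : choiceType) (Lambda : J -> groupClosed Gamma)
  (LambdaH : range Lambda `<=` range H)
  (LambdaP : forall i, exists! j, exists g, H i = conjsg g (Lambda j))
  (r : forall j, coset_repr (Lambda j))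
  (E : J -> topologicalType)
  (actE : forall j, subgroup_type (Lambda j) -> E j -> E j)
  (modelE : forall j, is_model R (restrict_family (Lambda j) Ft) (actE j))
  (X : topologicalType) (actX : Gamma -> X -> X)
  (modelX : is_model R F actX) :
  is_model R Ft
    (join_act (R := R) actX
      (coprod_act (fun j => induced_act (actE j) (r j)))).
Proof.
have [gcwX fixX] := modelX.
have [IX [dX [HX [QX gcX]]]] := is_gcw_gcells gcwX.
have [IE [dE [HE [QE gcE]]]] : exists (IE : J -> Type) (dE : forall j, IE j -> nat)
    (HE : forall j, IE j -> groupClosed (subgroup_type (Lambda j)))
    (QE : forall j i, 'rV[R]_(dE j i) -> E j),
    forall j, gcells (actE j) (HE j) (QE j).
  pose cells j := is_gcw_gcells (modelE j).1.
  exists (fun j => projT1 (cid (cells j))); pose p1 j := projT2 (cid (cells j)).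
  exists (fun j => projT1 (cid (p1 j))); pose p2 j := projT2 (cid (p1 j)).
  exists (fun j => projT1 (cid (p2 j))); pose p3 j := projT2 (cid (p2 j)).
  by exists (fun j => projT1 (cid (p3 j))) => j; exact: projT2 (cid (p3 j)).
have gcY := coprod_gcells (fun j => induced_gcells (r j) (gcE j)).
set actY := coprod_act _ in gcY *.
split; first exact: gcells_is_gcw (join_gcells gcX gcY).
have fixY M j A (e : E j) : fixed_set actY M (existT _ j (existT _ A e)) <->
    {subset M <= conjsg (r j A) (Lambda j)} /\
    fixed_set (actE j) (preim_sg (conjsg (r j A)^-1%g M)) e.
  by rewrite fixed_set_coprod fixed_set_induced.
move=> M; split=> [FtM|nFtM]; last first.
  have [_ X0] := fixX M; have {}X0 := X0 (fun FM => nFtM (subFFt _ FM)).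
  rewrite (fixed_set_join (AX := set0) (esym X0) erefl).
  apply/seteqP; split=> -[x|x t y|[j [A e]]] //=; first by case.
  move=> /fixY[ML fe].
  have nK : ~ restrict_family (Lambda j) Ft (preim_sg (conjsg (r j A)^-1%g M)).
    by move/(restrict_familyP famFt ML).
  by have [_ /(_ nK) E0] := (modelE j).2 (preim_sg (conjsg (r j A)^-1%g M));
    rewrite E0 in fe.
(* For [M] in [F] the fixed set is a join with a contractible factor; otherwise
   it is the fixed set of [M] in the only copy of some [E j] that [M] preserves. *)
have [FM|nFM] := pselect (F M).
  have [cX _] := fixX M.
  rewrite (fixed_set_join erefl erefl).
  apply: (contractible_subjoin gcX gcY) (cX FM).
    exact: closed_fixed_set (gc_action gcX) (gc_hausdorff gcX).
  exact: closed_fixed_set (gc_action gcY) (gc_hausdorff gcY).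
have [_ /(_ nFM) X0] := fixX M.
have [_ _ _ /(_ M (conj FtM nFM))[K [i _ Hi] MK]] := adaptedH.
have [j [[g Hg] _]] := LambdaP i.
subst K; rewrite Hg in MK.
pose A := lcoset_act g (@lcoset1 _ (Lambda j)).
have Ag : val A g.
  rewrite /A -[X in val _ X]mulg1 mem_lcoset_act /= /lcoset_set /= invg1 mul1g.
  exact: gpred1.
have MA : {subset M <= conjsg (r j A) (Lambda j)}.
  by rewrite -(conjsg_eq (lcosets_div Ag (coset_reprP (r j) A))).
rewrite (fixed_set_join (AX := set0) (esym X0) erefl).
pose Y := {j : J & induced_space (Lambda j) (E j)}.
rewrite (_ : subjoin _ _ = @join_inr R X Y @`
  (existT (fun j => induced_space (Lambda j) (E j)) j @`
  (existT (fun=> E j) A @`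
  fixed_set (actE j) (preim_sg (conjsg (r j A)^-1%g M))))).
  apply: contractible_closed_embedding.
  - exact: join_inr_continuous (gc_hausdorff gcX) (gc_hausdorff gcY).
  - by move=> y y' [].
  - by move=> C cC; exact: (closed_join_inr (gc_hausdorff gcX) (gc_hausdorff gcY)).
  apply: contractible_closed_embedding.
  - exact: existT_continuous.
  - by move=> y y' e; exact: (existT_inj e).
  - exact: closed_existT.
  apply: contractible_closed_embedding.
  - exact: (@existT_continuous (lcosets (Lambda j)) (fun=> E j)).
  - by move=> y y' e; exact: (existT_inj e).
  - exact: (@closed_existT (lcosets (Lambda j)) (fun=> E j)).
  by apply: ((modelE j).2 _).1; apply/(restrict_familyP famFt MA).
apply/seteqP; split.
  move=> [x|x t y|[j' [A' e]]] //=; first by case.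
  move=> /fixY[MA' fe]; exists (existT _ j' (existT _ A' e)) => //.
  have [ej aa'] := unique_fixed_coset famF adaptedH LambdaH LambdaP nFM MA MA'.
  subst j'; have eA : A = A'.
    apply: lcosets_eq (coset_reprP (r j) A') => //.
    by rewrite (lcosetsP (coset_reprP (r j) A)).
  by subst A'; exists (existT _ A e) => //; exists e.
by move=> _ [_ [_ [e fe <-] <-] <-]; apply/fixY.
Qed.
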